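(* For real $t>4$, consider the two one-parameter families of tetrahedra given by their edge lengths $(e_{12},e_{34},e_{13},e_{24},e_{14},e_{23})$: $$T=\left(t+1,\ t-1,\ t+1,\ t-1,\ t,\ 6\right),\qquad T'=\left(t+1,\ t-1,\ \tfrac{t}{2}+2,\ \tfrac{t}{2}+4,\ \tfrac{t}{2}+3,\ \tfrac{3t}{2}-3\right).$$ Then: (1) For every $t>4$, both $T$ and $T'$ have Dehn invariant zero. (2) For each of the two families, for almost every $t>4$ the $\mathbb{Q}$-span in $\mathbb{R}/\mathbb{Q}\pi$ of the six dihedral angles has dimension exactly $2$. (3) Neither family is identical to, or Regge equivalent to, any of the three Hill families $H_1,H_2,H_3$; and $T$ and $T'$ are the only families in their Regge equivalence class, i.e. the families Regge equivalent to $T$ are exactly $T$ and $T'$.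
   Context: Label the vertices of a tetrahedron $1,2,3,4$; $e_{ij}$ is the length of edge $ij$ and $\alpha_{ij}$ the dihedral angle along it. Edge lengths and dihedral angles are listed in the order $(12,34,13,24,14,23)$, i.e. as three consecutive pairs of opposite edges. The Dehn invariant is $\sum_{1\le i<j\le 4} e_{ij}\otimes\alpha_{ij}\in\mathbb{R}\otimes_{\mathbb{Q}}(\mathbb{R}/\mathbb{Q}\pi)$. Regge symmetries: the Regge symmetry fixing the first pair sends a tetrahedron with edge lengths $(x,y,a,b,c,d)$ to the tetrahedron with edge lengths $(x,y,s-a,s-b,s-c,s-d)$, $s=(a+b+c+d)/2$ (it is a known theorem that this is again a tetrahedron). The Regge symmetries fixing the second pair or the third pair are defined analogously: the two lengths in the fixed pair are unchanged, and each of the other four lengths $\ell$ is replaced by $s-\ell$, where $s$ is half the sum of those four lengths. Families are regarded as sets of tetrahedra up to similarity and up to relabelling of the four vertices (the action of $S_4$). Two families are Regge equivalent if one is carried onto the other by a finite composition of Regge symmetries and vertex relabellings. Hill families: with parameter $\alpha\in(0,\pi)$, restricted to those $\alpha$ for which the listed quantities are the edge lengths of a nondegenerate tetrahedron, in the order $(12,34,13,24,14,23)$: $H_1$: $(\sin\alpha,\ \sin\alpha,\ \sqrt3\cos\alpha,\ \sin\alpha,\ 1,\ 1)$; $H_2$: $(2\sin\alpha,\ \sqrt{5\sin^2\alpha-1},\ \sqrt3\cos\alpha,\ 2\sin\alpha,\ 2,\ \sqrt{5\sin^2\alpha-1})$; $H_3$: $(2\sin\alpha,\ \sqrt{\sin^2\alpha+2},\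 \sqrt{12}\cos\alpha,\ \sin\alpha,\ \sqrt{\sin^2\alpha+2},\ 2)$. *)

(* Defs.v *)
From HB Require Import structures.
From mathcomp Require Import all_boot all_order all_algebra all_fingroup.
From mathcomp Require Import generic_quotient ring_quotient.
From mathcomp Require Import all_classical all_reals all_analysis.
From mathcomp Require Import freeg.

Set Implicit Arguments.
Unset Strict Implicit.
Unset Printing Implicit Defensive.

Import Order.TTheory GRing.Theory Num.Theory.

Local Open Scope classical_set_scope.
Local Open Scope ring_scope.

Section LinearSpan.
Variables (K : comNzRingType) (V : lmodType K).
Implicit Types A : set V.

Definition lspan A : {pred V} := fun x =>
  `[< exists (n : nat) (c : 'I_n -> K) (v : 'I_n -> V),
        (forall i, A (v i)) /\ x = \sum_(i < n) c i *: v i >].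

Lemma lspanP A x :
  reflect (exists (n : nat) (c : 'I_n -> K) (v : 'I_n -> V),
    (forall i, A (v i)) /\ x = \sum_(i < n) c i *: v i) (x \in lspan A).
Proof. exact: asboolP. Qed.

Lemma mem_lspan A x : A x -> x \in lspan A.
Proof.
move=> Ax; apply/lspanP; exists 1%N, (fun=> 1), (fun=> x).
by split=> //; rewrite big_ord1 scale1r.
Qed.

Lemma lspan_submod_closed A : submod_closed (lspan A).
Proof.
split=> [|a x y /lspanP[m [c [v [Av ->]]]] /lspanP[n [d [w [Aw ->]]]]].
  by apply/lspanP; exists 0%N, (fun=> 0), (fun=> 0); split=> [[]|]; rewrite ?big_ord0.
apply/lspanP; exists (m + n)%N,
  (fun k => match fintype.split k with inl i => a * c i | inr j => d j end),
  (fun k => match fintype.split k with inl i => v i | inr j => w j end).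
split=> [k|]; first by case: (fintype.split k).
rewrite big_split_ord scaler_sumr; congr (_ + _); apply: eq_bigr => i _.
  by rewrite -[lshift n i]/(unsplit (inl i)) unsplitK scalerA.
by rewrite -[rshift m i]/(unsplit (inr i)) unsplitK.
Qed.

HB.instance Definition _ A :=
  GRing.isSubmodClosed.Build K V (lspan A) (lspan_submod_closed A).

Definition lin_indep (n : nat) (b : 'I_n -> V) :=
  forall c : 'I_n -> K, \sum_(i < n) c i *: b i = 0 -> forall i, c i = 0.

(** The submodule spanned by [A] is free of rank [n]. *)
Definition span_dim A (n : nat) :=
  exists b : 'I_n -> V, lin_indep b /\ lspan (range b) =i lspan A.

End LinearSpan.

(** The quotient of [V] by the submodule spanned by [A].  The library quotient
    [Quotient.quot] is only an additive group. *)
Section LmodQuotient.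
Variables (K : comNzRingType) (V : lmodType K) (A : set V).

Definition lquot := Quotient.quot (lspan A).

HB.instance Definition _ := GRing.Zmodule.on lquot.

Definition lclass (x : V) : lquot := \pi_(Quotient.quot (lspan A))%qT x.

Lemma lclass_eq x y : (lclass x == lclass y) = (x - y \in lspan A).
Proof. by rewrite /lclass -Quotient.idealrBE. Qed.

Lemma lclassD : {morph lclass : x y / x + y}.
Proof. by move=> x y; rewrite /lclass !piE. Qed.

Definition lclass_repr (x : lquot) : V := repr (x : Quotient.quot (lspan A)).

Lemma lclass_reprK : cancel lclass_repr lclass.
Proof. by move=> x; exact: reprK. Qed.

Definition lquot_scale (a : K) (x : lquot) : lquot := lclass (a *: lclass_repr x).

Lemma lquot_scaleE a x : lquot_scale a (lclass x) = lclass (a *: x).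
Proof.
apply/eqP; rewrite lclass_eq -scalerBr rpredZ //.
by rewrite -lclass_eq lclass_reprK.
Qed.

Lemma lquot_scaleA a b x :
  lquot_scale a (lquot_scale b x) = lquot_scale (a * b) x.
Proof. by rewrite -[x]lclass_reprK !lquot_scaleE scalerA. Qed.

Lemma lquot_scale1 : left_id 1 lquot_scale.
Proof. by move=> x; rewrite -[x]lclass_reprK lquot_scaleE scale1r. Qed.

Lemma lquot_scaleDr : right_distributive lquot_scale +%R.
Proof.
move=> a x y; rewrite -[x]lclass_reprK -[y]lclass_reprK.
by rewrite -lclassD !lquot_scaleE scalerDr lclassD.
Qed.

Lemma lquot_scaleDl x : {morph lquot_scale^~ x : a b / a + b}.
Proof.
move=> a b; rewrite -[x]lclass_reprK.
by rewrite !lquot_scaleE scalerDl lclassD.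
Qed.

HB.instance Definition _ := GRing.Zmodule_isLmodule.Build K lquot
  lquot_scaleA lquot_scale1 lquot_scaleDr lquot_scaleDl.

Lemma lclass_is_linear : linear lclass.
Proof. by move=> a x y; rewrite lclassD -lquot_scaleE. Qed.

HB.instance Definition _ :=
  GRing.isLinear.Build K V lquot *:%R lclass lclass_is_linear.

End LmodQuotient.

Section TensorProduct.
Variables (K : comNzRingType) (U V : lmodType K).

Local Notation pure u v := (<< (u, v) >> : {freeg (U * V) / K}).

Definition bilinear_relations : set {freeg (U * V) / K} :=
  [set x | (exists u u' v, x = pure (u + u') v - pure u v - pure u' v) \/
           (exists u v v', x = pure u (v + v') - pure u v - pure u v') \/
           (exists a u v, x = pure (a *: u) v - a *: pure u v) \/
           (exists a u v, x = pure u (a *: v) - a *: pure u v)].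

Definition tensor_product := lquot bilinear_relations.

HB.instance Definition _ := GRing.Lmodule.on tensor_product.

Definition tensor (u : U) (v : V) : tensor_product :=
  lclass bilinear_relations (pure u v).

Lemma tensorDl v : {morph tensor^~ v : u u' / u + u'}.
Proof.
move=> u u'; rewrite /tensor -linearD; apply/eqP; rewrite lclass_eq.
by rewrite opprD addrA; apply/mem_lspan; left; exists u, u', v.
Qed.

Lemma tensorDr u : {morph tensor u : v v' / v + v'}.
Proof.
move=> v v'; rewrite /tensor -linearD; apply/eqP; rewrite lclass_eq.
by rewrite opprD addrA; apply/mem_lspan; right; left; exists u, v, v'.
Qed.

Lemma tensorZl a u v : tensor (a *: u) v = a *: tensor u v.
Proof.
rewrite /tensor -linearZ; apply/eqP; rewrite lclass_eq.
by apply/mem_lspan; do 2!right; left; exists a, u, v.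
Qed.

Lemma tensorZr a u v : tensor u (a *: v) = a *: tensor u v.
Proof.
rewrite /tensor -linearZ; apply/eqP; rewrite lclass_eq.
by apply/mem_lspan; do 3!right; exists a, u, v.
Qed.

Lemma tensor_universal (W : lmodType K) (f : U -> V -> W) :
    (forall v, linear (f^~ v)) -> (forall u, linear (f u)) ->
  exists phi : {linear tensor_product -> W}, forall u v, phi (tensor u v) = f u v.
Proof.
move=> fl fr; pose g : {freeg (U * V) / K} -> W := fglift (fun p => f p.1 p.2).
have gB : {morph g : x y / x - y} by exact: lift_is_additive.
have g0 : g 0 = 0 by rewrite -(subrr 0) gB subrr.
have gD : {morph g : x y / x + y}.
  by move=> x y; rewrite -[y in LHS]opprK gB -[- y]sub0r gB g0 sub0r opprK.
have gU k p : g << k *g p >> = k *: f p.1 p.2 by rewrite /g liftU.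
have gZ k x : g (k *: x) = k *: g x.
  rewrite -{2}[x]freeg_sumE {1}/GRing.scale /= /fgscale.
  rewrite !(big_morph g gD g0) scaler_sumr.
  by apply: eq_bigr => p _; rewrite !gU scalerA.
have f0l v : f 0 v = 0 by have /= := fl v (-1) 0 0; rewrite scaler0 addr0 scaleN1r addNr.
have f0r u : f u 0 = 0 by have := fr u (-1) 0 0; rewrite scaler0 addr0 scaleN1r addNr.
have grel x : bilinear_relations x -> g x = 0.
  case=> [[u [u' [v ->]]]|[[u [v [v' ->]]]|[[a [u [v ->]]]|[a [u [v ->]]]]]];
    rewrite !gB ?gZ !gU !scale1r /=.
  - by have /= := fl v 1 u u'; rewrite !scale1r => ->; rewrite -addrA -opprD subrr.
  - by have /= := fr u 1 v v'; rewrite !scale1r => ->; rewrite -addrA -opprD subrr.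
  - by have /= := fl v a u 0; rewrite !addr0 f0l addr0 => ->; rewrite subrr.
  - by have /= := fr u a v 0; rewrite !addr0 f0r addr0 => ->; rewrite subrr.
have gker x : x \in lspan bilinear_relations -> g x = 0.
  case/lspanP => n [c [v [Av ->]]]; rewrite (big_morph g gD g0).
  by apply: big1 => i _; rewrite gZ grel ?scaler0.
pose h (x : tensor_product) : W := g (lclass_repr x).
have hE x : h (lclass _ x) = g x.
  apply/eqP; rewrite -subr_eq0 -gB gker //.
  by rewrite -lclass_eq lclass_reprK.
have hl : linear h.
  move=> a x y; rewrite -[x]lclass_reprK -[y]lclass_reprK.
  by rewrite -linearP !hE gD gZ.
pose hL := GRing.isLinear.Build K tensor_product W *:%R h hl.
pose phi : {linear tensor_product -> W} := HB.pack h hL.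
exists phi => u v.
by rewrite /= /tensor hE gU scale1r.
Qed.

End TensorProduct.

Section RationalSpaces.
Variable R : realType.

Definition ratvect : Type := R.

HB.instance Definition _ := GRing.Zmodule.on ratvect.

Definition ratvect_scale (q : rat) (x : ratvect) : ratvect :=
  ((ratr q : R) * (x : R))%R.

Lemma ratvect_scaleA p q x :
  ratvect_scale p (ratvect_scale q x) = ratvect_scale (p * q) x.
Proof. by rewrite /ratvect_scale rmorphM /= mulrA. Qed.

Lemma ratvect_scale1 : left_id 1 ratvect_scale.
Proof. by move=> x; rewrite /ratvect_scale rmorph1 mul1r. Qed.

Lemma ratvect_scaleDr : right_distributive ratvect_scale +%R.
Proof. by move=> q x y; rewrite /ratvect_scale -mulrDr. Qed.

Lemma ratvect_scaleDl x : {morph ratvect_scale^~ x : p q / p + q}.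
Proof. by move=> p q; rewrite /ratvect_scale rmorphD /= -mulrDl. Qed.

HB.instance Definition _ := GRing.Zmodule_isLmodule.Build rat ratvect
  ratvect_scaleA ratvect_scale1 ratvect_scaleDr ratvect_scaleDl.

Definition angle_space := lquot [set (pi : R) : ratvect].

HB.instance Definition _ := GRing.Lmodule.on angle_space.

Definition angle_class (x : R) : angle_space := lclass [set (pi : R) : ratvect] (x : ratvect).

End RationalSpaces.

Section Vertices.

Definition v1 : 'I_4 := @Ordinal 4 0 isT.
Definition v2 : 'I_4 := @Ordinal 4 1 isT.
Definition v3 : 'I_4 := @Ordinal 4 2 isT.
Definition v4 : 'I_4 := @Ordinal 4 3 isT.

(** Each edge, paired with the opposite edge, in the order 12, 34, 13, 24, 14, 23. *)
Definition edges : 6.-tuple (('I_4 * 'I_4) * ('I_4 * 'I_4)) :=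
  [tuple ((v1, v2), (v3, v4)); ((v3, v4), (v1, v2));
         ((v1, v3), (v2, v4)); ((v2, v4), (v1, v3));
         ((v1, v4), (v2, v3)); ((v2, v3), (v1, v4))].

End Vertices.

Section Tetrahedra.
Variable R : realType.
Implicit Types (u v : 'rV[R]_3) (P : 'I_4 -> 'rV[R]_3) (M : 'M[R]_4).

(** The library norm on row vectors is the sup norm. *)
Definition dotv u v : R := \sum_(i < 3) u 0 i * v 0 i.
Definition enorm u : R := Num.sqrt (dotv u u).

Definition nondegenerate_tetrahedron P :=
  row_free (\matrix_(i < 3) (P (fintype.lift v1 i) - P v1)).

Definition dist_mx P : 'M[R]_4 := \matrix_(i, j) enorm (P i - P j).

Definition vangle u v : R := acos (dotv u v / (enorm u * enorm v)).

Definition orth_part d u : 'rV[R]_3 := u - (dotv u d / dotv d d) *: d.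

(** Angle between the half-planes bounded by the line [ij] through [k] and [l]. *)
Definition dihedral P (ij kl : 'I_4 * 'I_4) : R :=
  let d := P ij.2 - P ij.1 in
  vangle (orth_part d (P kl.1 - P ij.1)) (orth_part d (P kl.2 - P ij.1)).

Definition edge_length P (k : 'I_6) : R :=
  let e := (tnth edges k).1 in enorm (P e.1 - P e.2).

Definition edge_angle P (k : 'I_6) : R :=
  let e := tnth edges k in dihedral P e.1 e.2.

Definition dehn P : tensor_product (ratvect R) (angle_space R) :=
  \sum_(k < 6) tensor (edge_length P k : ratvect R) (angle_class (edge_angle P k)).

Definition angle_span_dim P (n : nat) :=
  span_dim (range (fun k : 'I_6 => angle_class (edge_angle P k))) n.

(** Tetrahedra up to congruence are encoded by their matrix of edge lengths
    (row and column [i] belonging to vertex [i]). *)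
Definition edgemx (e12 e34 e13 e24 e14 e23 : R) : 'M[R]_4 :=
  \matrix_(i, j) nth 0 (nth [::]
    [:: [::   0; e12; e13; e14];
        [:: e12;   0; e23; e24];
        [:: e13; e23;   0; e34];
        [:: e14; e24; e34;   0]] i) j.

Definition is_tetrahedron M := exists P, nondegenerate_tetrahedron P /\ dist_mx P = M.

Definition relabel (s : 'S_4) M : 'M[R]_4 := \matrix_(i, j) M (s i) (s j).

Definition regge1 M : 'M[R]_4 :=
  let s := (M v1 v3 + M v2 v4 + M v1 v4 + M v2 v3) / 2 in
  edgemx (M v1 v2) (M v3 v4)
         (s - M v1 v3) (s - M v2 v4) (s - M v1 v4) (s - M v2 v3).

Definition regge2 M : 'M[R]_4 :=
  let s := (M v1 v2 + M v3 v4 + M v1 v4 + M v2 v3) / 2 in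
  edgemx (s - M v1 v2) (s - M v3 v4)
         (M v1 v3) (M v2 v4) (s - M v1 v4) (s - M v2 v3).

Definition regge3 M : 'M[R]_4 :=
  let s := (M v1 v2 + M v3 v4 + M v1 v3 + M v2 v4) / 2 in
  edgemx (s - M v1 v2) (s - M v3 v4)
         (s - M v1 v3) (s - M v2 v4) (M v1 v4) (M v2 v3).

Inductive regge_composite : ('M[R]_4 -> 'M[R]_4) -> Prop :=
| regge_composite_id : regge_composite id
| regge_composite_relabel s g : regge_composite g -> regge_composite (relabel s \o g)
| regge_composite_regge1 g : regge_composite g -> regge_composite (regge1 \o g)
| regge_composite_regge2 g : regge_composite g -> regge_composite (regge2 \o g)
| regge_composite_regge3 g : regge_composite g -> regge_composite (regge3 \o g).

(** All labelled tetrahedra obtained from members of [F] by similarity and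
    relabelling: a family regarded up to these identifications. *)
Definition shapes (F : set 'M[R]_4) : set 'M[R]_4 :=
  [set M | exists N s (c : R), F N /\ 0 < c /\ M = c *: relabel s N].

Definition same_family (F G : set 'M[R]_4) := shapes F = shapes G.

(** A single composite is applied to all members of [F] as they are labelled
    (Regge symmetries do not act on unlabelled tetrahedra); the result is
    compared with [G] up to similarity and relabelling. *)
Definition regge_equiv (F G : set 'M[R]_4) :=
  exists g, regge_composite g /\ same_family (g @` F) G.

Definition tetT (t : R) := edgemx (t + 1) (t - 1) (t + 1) (t - 1) t 6.

Definition tetT' (t : R) :=
  edgemx (t + 1) (t - 1) (t / 2 + 2) (t / 2 + 4) (t / 2 + 3) (3 * t / 2 - 3).

Definition familyT : set 'M[R]_4 := [set tetT t | t in [set t | 4 < t]].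
Definition familyT' : set 'M[R]_4 := [set tetT' t | t in [set t | 4 < t]].

Definition tetH1 (a : R) :=
  edgemx (sin a) (sin a) (Num.sqrt 3 * cos a) (sin a) 1 1.

Definition tetH2 (a : R) :=
  edgemx (2 * sin a) (Num.sqrt (5 * sin a ^+ 2 - 1)) (Num.sqrt 3 * cos a)
         (2 * sin a) 2 (Num.sqrt (5 * sin a ^+ 2 - 1)).

Definition tetH3 (a : R) :=
  edgemx (2 * sin a) (Num.sqrt (sin a ^+ 2 + 2)) (Num.sqrt 12 * cos a)
         (sin a) (Num.sqrt (sin a ^+ 2 + 2)) 2.

Definition hill_family (H : R -> 'M[R]_4) : set 'M[R]_4 :=
  [set H a | a in [set a | 0 < a < pi /\ is_tetrahedron (H a)]].

End Tetrahedra.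

(* Main.v *)
Require Import Defs.
From HB Require Import structures.
From mathcomp Require Import all_boot all_order all_algebra all_fingroup.
From mathcomp Require Import all_classical all_reals all_analysis.
From mathcomp Require Import ring lra.
Import Order.TTheory GRing.Theory Num.Theory.
Import numFieldNormedType.Exports.
Local Open Scope classical_set_scope.
Local Open Scope ring_scope.

(** Both families consist of tetrahedra with (6 V)^2 = 27 t^2 (t^2 - 16), V the
    volume, and the whole proof rests on one substitution,
    rho = sqrt (3 (t + 4) / (t - 4)).  The dihedral angle at an edge of length e
    is an argument of the complex number N + i e (6 V), where N is a polynomial
    in the squared edge lengths ([is_arg_dihedral]).  In terms of rho these
    twelve numbers factor, up to a positive scalar and a power of i, into
    factors 1 + i rho, 3 + i rho and their conjugates.  Hence, modulo rational
    multiples of pi, every dihedral angle of T and of T' is an explicit integral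
    combination of the two angles atan rho and atan (rho / 3)
    ([tetT_angle_class], [tetT'_angle_class]).

    With these integral coordinates the Dehn invariant is a sum of two tensors
    whose left entries are integral combinations of the edge lengths, and both
    combinations vanish ([dehn_eq0]).  The angles span at most dimension 2; they
    span exactly 2 when atan rho and atan (rho / 3) are rationally independent
    modulo pi.  For fixed rational coefficients c, d, not both zero, the
    derivative of c atan rho + d atan (rho / 3) vanishes for at most one positive
    rho, so by Rolle each level set has at most two points; only countably many
    t are therefore exceptional ([ae_angles_lin_indep]).

    A Regge symmetry is determined by one of the three perfect matchings of the
    vertices into opposite edges, and relabelling conjugates the matching
    ([regge_relabel]).  So words in Regge symmetries and relabellings act on T
    and T' through the three basic symmetries, which permute T and T' up to
    relabelling, uniformly in t ([regge_composite_tet]).  Moreover a Regge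
    symmetry permutes the three sums of opposite edges.  Two of these sums agree
    throughout T and T', a property invariant under all operations considered,
    while each Hill family has a member with three distinct sums
    ([unbalanced_not_equiv]); this separates the families. *)

(** * Arguments of plane vectors *)

(** [a] is an argument of X + i Y.  Since the modulus is left free, positive
    factors can be dropped and arguments are computed by polynomial arithmetic. *)
Definition is_arg {R : realType} (a X Y : R) :=
  exists2 r : R, 0 < r & X = r * cos a /\ Y = r * sin a.

Lemma is_argD {R : realType} (a b X Y X' Y' : R) :
  is_arg a X Y -> is_arg b X' Y' ->
  is_arg (a + b) (X * X' - Y * Y') (X * Y' + Y * X').
Proof.
move=> [r r0 [-> ->]] [s s0 [-> ->]]; exists (r * s); first exact: mulr_gt0.
by rewrite cosD sinD; split; ring.
Qed.

Lemma is_argN {R : realType} (a X Y : R) : is_arg a X Y -> is_arg (- a) X (- Y).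
Proof.
by move=> [r r0 [-> ->]]; exists r; rewrite // cosN sinN; split; ring.
Qed.

Lemma is_arg_scale {R : realType} (k a X Y X' Y' : R) :
  0 < k -> X' = k * X -> Y' = k * Y -> is_arg a X' Y' -> is_arg a X Y.
Proof.
move=> k0 eX eY [r r0 [hX hY]]; exists (k^-1 * r).
  by rewrite mulr_gt0 ?invr_gt0.
by rewrite -!mulrA -hX -hY eX eY !mulKf ?gt_eqF.
Qed.

Lemma is_arg_atan {R : realType} (c y : R) : 0 < c -> is_arg (atan (y / c)) c y.
Proof.
move=> c0; have cos0 : 0 < cos (atan (y / c)).
  by rewrite cos_atan invr_gt0 sqrtr_gt0 ltr_pwDl ?sqr_ge0.
exists (c / cos (atan (y / c))); first exact: divr_gt0.
split; first by rewrite mulfVK ?gt_eqF.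
have := atanK (y / c); rewrite /tan => h.
rewrite mulrAC -mulrA h.
by rewrite mulrCA mulfV ?mulr1 // gt_eqF.
Qed.

Lemma is_arg_acos {R : realType} (X Y D : R) :
  0 <= Y -> 0 < D -> X ^+ 2 + Y ^+ 2 = D ^+ 2 -> is_arg (acos (X / D)) X Y.
Proof.
move=> Y0 D0 e.
have e1 : 1 - (X / D) ^+ 2 = (Y / D) ^+ 2.
  have -> : (Y / D) ^+ 2 = Y ^+ 2 / D ^+ 2 by field; rewrite gt_eqF.
  have -> : Y ^+ 2 = D ^+ 2 - X ^+ 2 by rewrite -e; ring.
  by field; rewrite gt_eqF.
have h : -1 <= X / D <= 1.
  by rewrite -ler_norml -(@expr_le1 _ 2) // real_normK ?num_real // -subr_ge0 e1 sqr_ge0.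
exists D => //; rewrite acosK ?in_itv //= sin_acos // e1 sqrtr_sqr.
rewrite ger0_norm ?divr_ge0 ?(ltW D0) //.
by split; field; rewrite gt_eqF.
Qed.

Definition cmul {R : realType} (z w : R * R) : R * R :=
  (z.1 * w.1 - z.2 * w.2, z.1 * w.2 + z.2 * w.1).

(** Integer powers up to a positive factor: a negative power uses the conjugate
    in place of the inverse, which has the same argument. *)
Definition cexp {R : realType} (z : R * R) (m : int) : R * R :=
  match m with
  | Posz n => iter n (cmul z) (1, 0)
  | Negz n => iter n.+1 (cmul (z.1, - z.2)) (1, 0)
  end.

Lemma is_arg_cexp {R : realType} (a : R) (z : R * R) (m : int) :
  is_arg a z.1 z.2 -> is_arg (m%:~R * a) (cexp z m).1 (cexp z m).2.
Proof.
have nat_case (b : R) w n : is_arg b w.1 w.2 ->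
    is_arg (n%:R * b) (iter n (cmul w) (1, 0)).1 (iter n (cmul w) (1, 0)).2.
  move=> hb; elim: n => [|n IHn] /=.
    by exists 1 => //; rewrite mul0r cos0 sin0 !mul1r.
  by rewrite -natr1 mulrDl mul1r addrC; exact: is_argD hb IHn.
move=> ha; case: m => n; first exact: nat_case.
have -> : (Negz n)%:~R * a = n.+1%:R * - a by rewrite NegzE mulrNz mulNr mulrN.
by apply: (nat_case (- a) (z.1, - z.2) n.+1); exact: is_argN.
Qed.

(** * Angles modulo rational multiples of pi *)

Lemma sin_eq0_int {R : realType} (x : R) :
  sin x = 0 -> exists k : int, x = k%:~R * pi.
Proof.
move=> sx; pose k := Num.floor (x / pi); exists k.
have pi0 : 0 < pi :> R by exact: pi_gt0.
have /andP[hl hu] := real_floor_itv (num_real (x / pi)).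
rewrite -/k in hl hu.
have sy : sin (x - k%:~R * pi) = 0.
  have aux n y : sin (y + pi *+ n) = 0 <-> sin y = 0 :> R.
    rewrite (alternatingn (@sinDpi R)) -[(-1) ^+ n]signr_odd.
    case: (odd n); rewrite /= ?expr0 ?expr1 ?mul1r // mulN1r.
    by split=> [/eqP|->]; rewrite ?oppr0 // oppr_eq0 => /eqP.
  case: k {hl hu} => n; last first.
    rewrite NegzE mulrNz mulNr opprK -[_%:~R]/(n.+1%:R) mulr_natl.
    by apply/aux.
  by apply/(aux n); rewrite -[_%:~R]/(n%:R) mulr_natl subrK.
have y0 : 0 <= x - k%:~R * pi by rewrite subr_ge0 -ler_pdivlMr.
have ypi : x - k%:~R * pi < pi.
  by rewrite ltrBlDl -{2}[pi]mul1r -mulrDl addrC -ltr_pdivrMr // addrC -intrD1.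
apply/eqP; rewrite -subr_eq0; apply/eqP/eqP.
rewrite eq_le y0 andbT leNgt; apply/negP => ygt.
by have := @sin_gt0_pi R (x - k%:~R * pi); rewrite ygt ypi sy ltxx => /(_ isT).
Qed.

Lemma angle_class_is_linear {R : realType} (q : rat) (a b : R) :
  angle_class (ratr q * a + b) = q *: angle_class a + angle_class b.
Proof. exact: (@linearP _ _ _ _ (lclass [set (pi : R) : ratvect R])). Qed.

Lemma angle_classD {R : realType} (a b : R) :
  angle_class (a + b) = angle_class a + angle_class b.
Proof. exact: (@raddfD _ _ (lclass [set (pi : R) : ratvect R])). Qed.

Lemma angle_classN {R : realType} (a : R) :
  angle_class (- a) = - angle_class a.
Proof. exact: (@raddfN _ _ (lclass [set (pi : R) : ratvect R])). Qed.

Lemma angle_class_eq0P {R : realType} (a : R) :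
  angle_class a = 0 <-> exists q : rat, a = ratr q * pi.
Proof.
have -> : angle_class a = 0 <-> (a : ratvect R) \in lspan [set (pi : R) : ratvect R].
  rewrite -[X in _ \in X]/(lspan _) -[a in a \in _]subr0 -lclass_eq.
  have -> : lclass [set (pi : R) : ratvect R] 0 = 0.
    by rewrite (@raddf0 _ _ (lclass [set (pi : R) : ratvect R])).
  by split=> [/eqP|/eqP].
split=> [/lspanP[n [c [v [vA ->]]]]|[q ->]].
  exists (\sum_i c i); rewrite rmorph_sum mulr_suml.
  by apply: eq_bigr => i _; rewrite vA.
apply/lspanP; exists 1%N, (fun=> q), (fun=> (pi : R)).
by split=> //; rewrite big_ord1.
Qed.

(** A complex number on one of the coordinate axes has a multiple of pi / 2 as
    argument. *)
Lemma angle_class_arg_eq0 {R : realType} (a X Y : R) :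
  is_arg a X Y -> X * Y = 0 -> angle_class a = 0.
Proof.
move=> [r r0 [-> ->]] e; apply/angle_class_eq0P.
have /sin_eq0_int[k hk] : sin (a + a) = 0.
  have -> : sin (a + a) = 2 * (r * cos a * (r * sin a)) / r ^+ 2.
    by rewrite sinD; field; rewrite gt_eqF.
  by rewrite e mulr0 mul0r.
exists (k%:~R / 2); rewrite rmorphM fmorphV /= ratr_int ratr_nat.
by rewrite mulrAC -hk; field.
Qed.

Lemma angle_class0 {R : realType} : angle_class (0 : R) = 0.
Proof. by apply/angle_class_eq0P; exists 0; rewrite rmorph0 mul0r. Qed.

(** Congruence of angles is reduced to a polynomial identity: the quotient of the
    two complex numbers, computed as z times the conjugate of w, has to be real or
    purely imaginary. *)
Lemma angle_class_eq_arg {R : realType} (a b : R) (z w : R * R) :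
  is_arg a z.1 z.2 -> is_arg b w.1 w.2 ->
  (cmul z (w.1, - w.2)).1 = 0 \/ (cmul z (w.1, - w.2)).2 = 0 ->
  angle_class a = angle_class b.
Proof.
move=> ha hb h; apply/eqP; rewrite -subr_eq0 -angle_classN -angle_classD.
apply/eqP; apply: (angle_class_arg_eq0 _ _ _ (is_argD _ _ _ _ _ _ ha (is_argN _ _ _ hb))).
by apply/eqP; rewrite mulf_eq0; apply/orP; case: h => /= ->; [left|right].
Qed.

Lemma angle_class_comb {R : realType} (m n : int) (a b : R) :
  angle_class (m%:~R * a + n%:~R * b) =
  m%:~R *: angle_class a + n%:~R *: angle_class b.
Proof.
have h (k : int) (c : R) : angle_class (k%:~R * c) = k%:~R *: angle_class c.
  by rewrite -[k%:~R * c]addr0 -(ratr_int R) angle_class_is_linear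
    angle_class0 addr0.
by rewrite angle_classD !h.
Qed.

(** * Dihedral angles from edge lengths *)

Lemma dotvE {R : realType} (u v : 'rV[R]_3) :
  dotv u v = u 0 0 * v 0 0 + u 0 1 * v 0 1 + u 0 2%:R * v 0 2%:R.
Proof.
rewrite /dotv !big_ord_recl big_ord0 addr0 addrA.
by congr (_ + u 0 _ * v 0 _ + u 0 _ * v 0 _); apply/val_inj.
Qed.

Lemma dotv_ge0 {R : realType} (u : 'rV[R]_3) : 0 <= dotv u u.
Proof. by apply: sumr_ge0 => i _; rewrite -expr2 sqr_ge0. Qed.

Lemma enorm_sqr {R : realType} (u : 'rV[R]_3) : enorm u ^+ 2 = dotv u u.
Proof. by rewrite sqr_sqrtr // dotv_ge0. Qed.

Lemma is_arg_vangle {R : realType} (u v : 'rV[R]_3) (W : R) :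
  0 < dotv u u -> 0 < dotv v v -> 0 <= W ->
  dotv u v ^+ 2 + W ^+ 2 = dotv u u * dotv v v ->
  is_arg (vangle u v) (dotv u v) W.
Proof.
move=> u0 v0 W0 e; apply: is_arg_acos => //.
  by rewrite mulr_gt0 ?sqrtr_gt0.
by rewrite exprMn !enorm_sqr.
Qed.

Lemma dotv_orth_part {R : realType} (d u v : 'rV[R]_3) : dotv d d != 0 ->
  dotv (orth_part d u) (orth_part d v) =
  (dotv u v * dotv d d - dotv u d * dotv v d) / dotv d d.
Proof.
by move=> d0; rewrite /orth_part; move: d0; rewrite !dotvE !mxE => d0; field.
Qed.

Definition gram_det {R : realType} (d u v : 'rV[R]_3) : R :=
  dotv d d * (dotv u u * dotv v v - dotv u v ^+ 2)
  - dotv u d * (dotv u d * dotv v v - dotv u v * dotv v d)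
  + dotv v d * (dotv u d * dotv u v - dotv u u * dotv v d).

(** The identity (u.v d.d - u.d v.d)^2 + d.d gram_det = D_u D_v, where
    D_u = u.u d.d - (u.d)^2, gives the sine of the angle: its numerator involves
    only the length of [d] and the volume, so that one square root [W] serves all
    six edges of a tetrahedron. *)
Lemma is_arg_half_planes {R : realType} (d u v : 'rV[R]_3) (W : R) :
  0 < dotv d d -> 0 < W -> W ^+ 2 = gram_det d u v ->
  is_arg (vangle (orth_part d u) (orth_part d v))
    (dotv u v * dotv d d - dotv u d * dotv v d) (enorm d * W).
Proof.
move=> d0 W0 eW; have dn0 : dotv d d != 0 by rewrite gt_eqF.
have e0 : 0 < enorm d by rewrite sqrtr_gt0.
have eU := dotv_orth_part d u u dn0; have eV := dotv_orth_part d v v dn0.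
have eUV := dotv_orth_part d u v dn0.
have key : dotv (orth_part d u) (orth_part d v) ^+ 2 + (W / enorm d) ^+ 2 =
           dotv (orth_part d u) (orth_part d u) *
           dotv (orth_part d v) (orth_part d v).
  by rewrite expr_div_n enorm_sqr eW eU eV eUV /gram_det; field.
have pos : 0 < dotv (orth_part d u) (orth_part d u) *
           dotv (orth_part d v) (orth_part d v).
  by rewrite -key ltr_wpDl ?sqr_ge0 // exprn_gt0 ?divr_gt0.
have /andP[nU nV] : (dotv (orth_part d u) (orth_part d u) != 0) &&
                    (dotv (orth_part d v) (orth_part d v) != 0).
  by rewrite -negb_or -mulf_eq0 gt_eqF.
apply: (@is_arg_scale _ (dotv d d)^-1 _ _ _ _ (W / enorm d)); last first.
- apply: is_arg_vangle key; rewrite ?divr_ge0 ?(ltW W0) ?(ltW e0) //.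
    by rewrite lt_neqAle eq_sym nU dotv_ge0.
  by rewrite lt_neqAle eq_sym nV dotv_ge0.
- by rewrite -enorm_sqr; field; rewrite gt_eqF.
- by rewrite eUV mulrC.
- by rewrite invr_gt0.
Qed.

(** By polarization, the inner product of the edges [oa] and [ob]. *)
Definition dist_dot {R : realType} (M : 'M[R]_4) (o a b : 'I_4) : R :=
  (M o a ^+ 2 + M o b ^+ 2 - M a b ^+ 2) / 2.

Lemma dotv_dist_dot {R : realType} (P : 'I_4 -> 'rV[R]_3) (o a b : 'I_4) :
  dotv (P a - P o) (P b - P o) = dist_dot (dist_mx P) o a b.
Proof.
by rewrite /dist_dot !mxE !enorm_sqr !dotvE !mxE; field.
Qed.

(** |ij|^2 times the inner product of the components of the edges [ik] and [il]
    orthogonal to [ij]. *)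
Definition dihedral_cosnum {R : realType} (M : 'M[R]_4) (i j k l : 'I_4) : R :=
  dist_dot M i k l * dist_dot M i j j - dist_dot M i k j * dist_dot M i l j.

(** The Gram determinant of the three edges at [i], that is 36 times the squared
    volume. *)
Definition dist_gram {R : realType} (M : 'M[R]_4) (i j k l : 'I_4) : R :=
  let g := dist_dot M i in
  g j j * (g k k * g l l - g k l ^+ 2) - g k j * (g k j * g l l - g k l * g l j)
  + g l j * (g k j * g k l - g k k * g l j).

Lemma is_arg_dihedral {R : realType} (P : 'I_4 -> 'rV[R]_3) (M : 'M[R]_4)
    (i j k l : 'I_4) (W : R) :
  dist_mx P = M -> 0 < M i j -> 0 < W -> W ^+ 2 = dist_gram M i j k l ->
  is_arg (dihedral P (i, j) (k, l)) (dihedral_cosnum M i j k l) (M i j * W).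
Proof.
move=> <- e0 W0 eW; rewrite /dihedral_cosnum /= -!dotv_dist_dot.
have eij : dist_mx P i j = enorm (P j - P i).
  by rewrite mxE /enorm; congr Num.sqrt; rewrite !dotvE !mxE; ring.
rewrite eij in e0 *; apply: is_arg_half_planes => //.
  by rewrite -sqrtr_gt0.
by rewrite eW /dist_gram /= -!dotv_dist_dot.
Qed.

Definition edge_ends (k : 'I_6) := nth ((v1, v2), (v3, v4)) edges k.

Lemma edge_lengthE {R : realType} (P : 'I_4 -> 'rV[R]_3) (M : 'M[R]_4) (k : 'I_6) :
  dist_mx P = M -> edge_length P k = M (edge_ends k).1.1 (edge_ends k).1.2.
Proof.
by move=> <-; rewrite /edge_length mxE (tnth_nth ((v1, v2), (v3, v4))).
Qed.

Lemma is_arg_edge_angle {R : realType} (P : 'I_4 -> 'rV[R]_3) (M : 'M[R]_4)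
    (k : 'I_6) (W c : R) (z : R * R) :
  let: ((i, j), (i', j')) := edge_ends k in
  dist_mx P = M -> 0 < W -> 0 < c -> 0 < M i j -> W ^+ 2 = dist_gram M i j i' j' ->
  dihedral_cosnum M i j i' j' = c * z.1 -> M i j * W = c * z.2 ->
  is_arg (edge_angle P k) z.1 z.2.
Proof.
rewrite /edge_angle (tnth_nth ((v1, v2), (v3, v4))) -/(edge_ends k).
case: (edge_ends k) => [[i j] [i' j']] eP W0 c0 e0 eW e1 e2.
exact: is_arg_scale c0 e1 e2 (is_arg_dihedral _ _ _ _ _ _ _ eP e0 W0 eW).
Qed.

(** * Existence of tetrahedra with given edge lengths *)

Lemma ord4_cases (i : 'I_4) : [\/ i = v1, i = v2, i = v3 | i = v4].
Proof.
case: i => [[|[|[|[|i]]]] hi] //.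
- by constructor 1; apply/val_inj.
- by constructor 2; apply/val_inj.
- by constructor 3; apply/val_inj.
- by constructor 4; apply/val_inj.
Qed.

(** Cholesky factorization under Sylvester's criterion: the squares of the three
    diagonal entries are the quotients of successive leading minors. *)
Lemma cholesky3 {R : realType} (g22 g23 g24 g33 g34 g44 : R) :
  0 < g22 -> 0 < g22 * g33 - g23 ^+ 2 ->
  0 < g22 * (g33 * g44 - g34 ^+ 2) - g23 * (g23 * g44 - g34 * g24)
      + g24 * (g23 * g34 - g33 * g24) ->
  exists a b c d e f : R, [/\ 0 < a, 0 < c & 0 < f] /\
  [/\ a ^+ 2 = g22, a * b = g23 & a * d = g24] /\
  [/\ b ^+ 2 + c ^+ 2 = g33, b * d + c * e = g34 &
      d ^+ 2 + e ^+ 2 + f ^+ 2 = g44].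
Proof.
move=> g0 D0 G0; set D := g22 * g33 - _ in D0.
set G := (X in 0 < X) in G0.
have gn0 : g22 != 0 by rewrite gt_eqF.
have Dn0 : D != 0 by rewrite gt_eqF.
have a0 : 0 < Num.sqrt g22 by rewrite sqrtr_gt0.
have an0 : Num.sqrt g22 != 0 by rewrite gt_eqF.
have a2 : Num.sqrt g22 ^+ 2 = g22 by rewrite sqr_sqrtr // ltW.
set a := Num.sqrt g22 in a0 an0 a2.
have c0 : 0 < Num.sqrt (D / g22) by rewrite sqrtr_gt0 divr_gt0.
have cn0 : Num.sqrt (D / g22) != 0 by rewrite gt_eqF.
have c2 : Num.sqrt (D / g22) ^+ 2 = D / g22.
  by rewrite sqr_sqrtr // ltW // divr_gt0.
set c := Num.sqrt (D / g22) in c0 cn0 c2.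
exists a, (g23 / a), c, (g24 / a), ((g34 - g23 * g24 / g22) / c).
exists (Num.sqrt (G / D)); split.
  by split=> //; rewrite sqrtr_gt0 divr_gt0.
split; first by split=> //; field.
rewrite [Num.sqrt (G / D) ^+ 2]sqr_sqrtr; last by rewrite ltW // divr_gt0.
rewrite !expr_div_n c2 a2; split.
- by rewrite /D; field.
- by rewrite mulrACA -invfM -expr2 a2 mulrCA mulfV //; ring.
- by rewrite /G /D; field; rewrite gn0 -/D Dn0.
Qed.

Section Existence.
Variables (R : realType) (e12 e34 e13 e24 e14 e23 : R).
Let M := edgemx e12 e34 e13 e24 e14 e23.

(** The vertices are the origin and the rows of the Cholesky factor of the Gram
    matrix of the edges at vertex 1. *)
Lemma is_tetrahedron_edgemx :
  0 < e12 -> 0 <= e34 -> 0 <= e13 -> 0 <= e24 -> 0 <= e14 -> 0 <= e23 ->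
  0 < dist_dot M v1 v2 v2 * dist_dot M v1 v3 v3 - dist_dot M v1 v2 v3 ^+ 2 ->
  0 < dist_gram M v1 v2 v3 v4 -> is_tetrahedron M.
Proof.
move=> h12 h34 h13 h24 h14 h23 D0 G0.
have [||] := @cholesky3 R (dist_dot M v1 v2 v2) (dist_dot M v1 v2 v3)
  (dist_dot M v1 v2 v4) (dist_dot M v1 v3 v3) (dist_dot M v1 v3 v4)
  (dist_dot M v1 v4 v4) _ D0.
- rewrite /dist_dot !mxE /=.
  have -> : (e12 ^+ 2 + e12 ^+ 2 - 0 ^+ 2) / 2 = e12 ^+ 2 by field.
  by rewrite exprn_gt0.
- have <- : dist_gram M v1 v2 v3 v4 =
    dist_dot M v1 v2 v2 *
    (dist_dot M v1 v3 v3 * dist_dot M v1 v4 v4 - dist_dot M v1 v3 v4 ^+ 2) -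
    dist_dot M v1 v2 v3 *
    (dist_dot M v1 v2 v3 * dist_dot M v1 v4 v4 -
     dist_dot M v1 v3 v4 * dist_dot M v1 v2 v4) +
    dist_dot M v1 v2 v4 *
    (dist_dot M v1 v2 v3 * dist_dot M v1 v3 v4 -
     dist_dot M v1 v3 v3 * dist_dot M v1 v2 v4).
    by rewrite /dist_gram /dist_dot !mxE /=; ring.
  done.
move=> a [b [c [d [e [f [[a0 c0 f0]]]]]]].
rewrite /dist_dot !mxE /= => -[[ha hb hd] [hc he hf]].
have k12 : e12 ^+ 2 = a ^+ 2 by rewrite ha; field.
have k13 : e13 ^+ 2 = b ^+ 2 + c ^+ 2 by rewrite hc; field.
have k14 : e14 ^+ 2 = d ^+ 2 + e ^+ 2 + f ^+ 2 by rewrite hf; field.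
have k23 : e23 ^+ 2 = a ^+ 2 + (b ^+ 2 + c ^+ 2) - 2 * (a * b).
  by rewrite ha hc hb; field.
have k24 : e24 ^+ 2 = a ^+ 2 + (d ^+ 2 + e ^+ 2 + f ^+ 2) - 2 * (a * d).
  by rewrite ha hf hd; field.
have k34 : e34 ^+ 2 = (b ^+ 2 + c ^+ 2) + (d ^+ 2 + e ^+ 2 + f ^+ 2)
                      - 2 * (b * d + c * e).
  by rewrite hc hf he; field.
pose P (i : 'I_4) : 'rV[R]_3 := \row_j
  nth 0 (nth [::] [:: [:: 0; 0; 0]; [:: a; 0; 0]; [:: b; c; 0]; [:: d; e; f]] i) j.
exists P; split.
  rewrite /nondegenerate_tetrahedron row_free_unit unitmxE det_trig.
    by rewrite !big_ord_recl big_ord0 !mxE /= !subr0 unitfE !mulf_neq0 ?oner_neq0 ?gt_eqF.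
  apply/is_trig_mxP => i j ij; rewrite !mxE.
  by case: i j ij => [[|[|[|i]]] hi] [[|[|[|j]]] hj] //= _; rewrite subr0.
apply/matrixP => i j.
have sq_ge0 (x y : R) : 0 <= y -> x = y ^+ 2 -> Num.sqrt x = y.
  by move=> y0 ->; rewrite sqrtr_sqr ger0_norm.
by case: (ord4_cases i) => ->; case: (ord4_cases j) => ->;
  rewrite [LHS]mxE; apply: sq_ge0;
    rewrite /M ?[edgemx _ _ _ _ _ _ _ _]mxE //= ?(ltW h12) // dotvE !mxE /=
    ?(k12, k13, k14, k23, k24, k34); ring.
Qed.

End Existence.

(** * Dehn invariants and spans from integral coordinates of the angles *)

Lemma tensor0l {K : comNzRingType} {U V : lmodType K} (v : V) :
  tensor (0 : U) v = 0.
Proof. by rewrite -(scale0r (0 : U)) tensorZl scale0r. Qed.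

Lemma tensor_suml {K : comNzRingType} {U V : lmodType K} (n : nat)
    (u : 'I_n -> U) (v : V) :
  tensor (\sum_(i < n) u i) v = \sum_(i < n) tensor (u i) v.
Proof.
by apply: (big_morph (fun u => tensor u v)); [exact: tensorDl|exact: tensor0l].
Qed.

(** The integer multiplicities move across the tensor sign, which collects the
    Dehn invariant into one tensor over [a] and one over [b]. *)
Lemma dehn_eq0 {R : realType} (P : 'I_4 -> 'rV[R]_3)
    (a b : angle_space R) (m : 'I_6 -> int * int) :
  (forall k, angle_class (edge_angle P k) = (m k).1%:~R *: a + (m k).2%:~R *: b) ->
  \sum_(k < 6) (m k).1%:~R * edge_length P k = 0 ->
  \sum_(k < 6) (m k).2%:~R * edge_length P k = 0 ->
  dehn P = 0.
Proof.
move=> hm s1 s2.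
have slide (n : int) (e : R) (c : angle_space R) :
    tensor (e : ratvect R) (n%:~R *: c) = tensor (n%:~R * e : ratvect R) c.
  rewrite tensorZr -tensorZl; congr (tensor _ c).
  by rewrite -(ratr_int R).
rewrite /dehn; under eq_bigr do rewrite hm tensorDr !slide.
by rewrite big_split /= -!tensor_suml s1 s2 !tensor0l addr0.
Qed.

Lemma lspan_sub {K : comNzRingType} {V : lmodType K} (A B : set V) :
  (forall x, A x -> x \in lspan B) -> {subset lspan A <= lspan B}.
Proof.
move=> AB x /lspanP[n [c [v [Av ->]]]].
by apply: rpred_sum => i _; apply: rpredZ; apply: AB.
Qed.

Lemma span_dim2 {K : comNzRingType} {V : lmodType K} (A : set V) (a b : V) :
  (forall c d : K, c *: a + d *: b = 0 -> c = 0 /\ d = 0) ->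
  a \in lspan A -> b \in lspan A ->
  (forall x, A x -> exists c d : K, x = c *: a + d *: b) ->
  span_dim A 2.
Proof.
move=> indep Aa Ab AE; pose e (i : 'I_2) := if i == 0 then a else b.
exists e; split.
  move=> c; rewrite !big_ord_recl big_ord0 addr0 => /indep[c0 c1] i.
  by case: i => [[|[|i]]] hi //; [rewrite -c0|rewrite -c1]; congr c; apply/val_inj.
move=> x; apply/idP/idP; apply: lspan_sub => {x} x.
  by move=> [i _ <-]; rewrite /e; case: ifP.
move=> /AE[c [d ->]]; apply: rpredD; apply: rpredZ; apply: mem_lspan.
  by exists 0.
by exists 1.
Qed.

(** The rows (c, d) and (c', d') invert the 2 x 2 matrix of the coordinates of the
    angles at edges [k] and [l], which recovers [a] and [b] from these two angles. *)
Lemma span_dim_lattice {R : realType} (P : 'I_4 -> 'rV[R]_3) (k l : 'I_6)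
    (c d c' d' : rat) (a b : angle_space R) (m : 'I_6 -> int * int) :
  (forall c d : rat, c *: a + d *: b = 0 -> c = 0 /\ d = 0) ->
  (forall k, angle_class (edge_angle P k) = (m k).1%:~R *: a + (m k).2%:~R *: b) ->
  c * (m k).1%:~R + d * (m l).1%:~R = 1 -> c * (m k).2%:~R + d * (m l).2%:~R = 0 ->
  c' * (m k).1%:~R + d' * (m l).1%:~R = 0 -> c' * (m k).2%:~R + d' * (m l).2%:~R = 1 ->
  angle_span_dim P 2.
Proof.
move=> indep hm e1 e2 e3 e4.
have mem (c0 d0 : rat) :
    (c0 * (m k).1%:~R + d0 * (m l).1%:~R) *: a +
    (c0 * (m k).2%:~R + d0 * (m l).2%:~R) *: b \in
    lspan (range (fun k : 'I_6 => angle_class (edge_angle P k))).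
  rewrite !scalerDl -!scalerA addrACA -!scalerDr -!hm.
  by apply: rpredD; apply: rpredZ; apply: mem_lspan; eexists.
apply: (span_dim2 _ _ _ indep).
- by have := mem c d; rewrite e1 e2 scale1r scale0r addr0.
- by have := mem c' d'; rewrite e3 e4 scale1r scale0r add0r.
- by move=> _ [j _ <-]; rewrite hm; do 2 eexists.
Qed.

(** * The dihedral angles of the two families *)

Section Families.
Variables (R : realType) (t : R).
Hypothesis t4 : 4 < t.

(** The parameter that makes the dihedral angles arguments of products of
    1 + i rho, 3 + i rho and their conjugates. *)
Definition slope : R := Num.sqrt (3 * (t + 4) / (t - 4)).
Local Notation rho := slope.

Lemma slope_sqr : rho ^+ 2 * (t - 4) = 3 * (t + 4).
Proof.
have h : 0 < t - 4 by rewrite subr_gt0.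
rewrite sqr_sqrtr; first by rewrite mulfVK // gt_eqF.
by rewrite divr_ge0 ?(ltW h) //; move: t4; lra.
Qed.

Lemma slope_gt0 : 0 < rho.
Proof.
by rewrite sqrtr_gt0 divr_gt0 ?subr_gt0 // mulr_gt0 //; move: t4; lra.
Qed.

Definition first_angle : R := atan rho.
Definition second_angle : R := atan (rho / 3).

Lemma is_arg_first_angle : is_arg first_angle 1 rho.
Proof. by have := @is_arg_atan R 1 rho ltr01; rewrite divr1. Qed.

Lemma is_arg_second_angle : is_arg second_angle 3 rho.
Proof. by apply: is_arg_atan; lra. Qed.

(** Six times the volume, for T as well as for T'. *)
Definition gram_root : R := 3 * t * (rho * (t - 4)).

Lemma gram_root_gt0 : 0 < gram_root.
Proof.
by rewrite /gram_root !mulr_gt0 ?slope_gt0 ?subr_gt0 //; move: t4; lra.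
Qed.

Lemma slopeK : t = 4 * (rho ^+ 2 + 3) / (rho ^+ 2 - 3) /\ 0 < rho ^+ 2 - 3.
Proof.
have h := slope_sqr.
have p : 0 < rho ^+ 2 - 3.
  rewrite -(@pmulr_lgt0 _ (t - 4)) ?subr_gt0 //.
  have -> : (rho ^+ 2 - 3) * (t - 4) = rho ^+ 2 * (t - 4) - 3 * (t - 4) by ring.
  by rewrite h; lra.
split=> //; apply: (mulIf (lt0r_neq0 p)); rewrite mulfVK ?lt0r_neq0 //.
have -> : t * (rho ^+ 2 - 3) = rho ^+ 2 * (t - 4) + 4 * rho ^+ 2 - 3 * t by ring.
by rewrite h; ring.
Qed.

Lemma gram_root_sqr : gram_root ^+ 2 = 27 * t ^+ 2 * (t + 4) * (t - 4).
Proof.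
have -> : gram_root ^+ 2 = 9 * t ^+ 2 * (t - 4) * (rho ^+ 2 * (t - 4)).
  by rewrite /gram_root; ring.
by rewrite slope_sqr; ring.
Qed.

(** Coordinates of the dihedral angles in terms of [first_angle] and
    [second_angle], modulo multiples of pi / 2.  For instance the entry (1, -2) of
    edge 12 comes from
    i (1 + i rho) (3 - i rho)^2 = (rho^3 - 3 rho) + i (5 rho^2 + 9). *)
Definition mulsT : seq (int * int) :=
  [:: (1, -2); (-2, 1); (1, -2); (-2, 1); (2, 2); (-1, 1)]%Z.
Definition mulsT' : seq (int * int) :=
  [:: (1, -2); (-2, 1); (-1, 3); (2, 0); (-2, -1); (1, 0)]%Z.

(** Each entry of [z] below is dihedral_cosnum + i e gram_root freed of the positive
    factor [c]; writing [t] as a function of rho then makes the factorization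
    recorded in [mulsT] a rational identity. *)
Lemma tetT_angle_class (P : 'I_4 -> 'rV[R]_3) (k : 'I_6) :
  dist_mx P = tetT t ->
  let m := nth (0, 0) mulsT k in
  angle_class (edge_angle P k) =
    m.1%:~R *: angle_class first_angle + m.2%:~R *: angle_class second_angle.
Proof.
move=> eP m; rewrite -angle_class_comb; have [et p] := slopeK.
have pn : rho ^+ 2 - 3 != 0 by rewrite gt_eqF.
pose S := rho * (t - 4).
pose z : R * R := nth (0, 0) [:: (3 * (t + 4), (t + 1) * S); (3 * (t - 4), (t - 1) * S);
  (3 * (t + 4), (t + 1) * S); (3 * (t - 4), (t - 1) * S);
  (t ^+ 2 - 28, 4 * S); (t ^+ 2 - 16, t * S)] k.
pose c : R := nth 0 [:: 3 * t; 3 * t; 3 * t; 3 * t; 3 / 4 * t ^+ 2; 18] k.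
apply: (@angle_class_eq_arg _ _ _ z (cmul (cexp (1, rho) m.1) (cexp (3, rho) m.2))).
- have := @is_arg_edge_angle R P _ k gram_root c z; move: eP.
  rewrite /z /c /m; clear z c m.
  case: k => [[|[|[|[|[|[|]]]]]] hk] //= eP /(_ _ eP gram_root_gt0); apply;
    rewrite ?gram_root_sqr /gram_root /dihedral_cosnum /dist_gram /dist_dot ?mxE /=.
  all: try by move: t4; lra.
  all: rewrite ?/S; try by field.
  by move: t4; nra.
- exact: (is_argD _ _ _ _ _ _ (is_arg_cexp first_angle (1, rho) m.1 is_arg_first_angle)
                             (is_arg_cexp second_angle (3, rho) m.2 is_arg_second_angle)).
rewrite /z /m /S; clear z c m.
case: k => [[|[|[|[|[|[|]]]]]] hk] //=; rewrite /cexp /cmul /=; rewrite et;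
  (* left: purely imaginary quotient, an odd power of i *)
  [left|right|left|right|right|left]; by field.
Qed.

Lemma tetT'_angle_class (P : 'I_4 -> 'rV[R]_3) (k : 'I_6) :
  dist_mx P = tetT' t ->
  let m := nth (0, 0) mulsT' k in
  angle_class (edge_angle P k) =
    m.1%:~R *: angle_class first_angle + m.2%:~R *: angle_class second_angle.
Proof.
move=> eP m; rewrite -angle_class_comb; have [et p] := slopeK.
have pn : rho ^+ 2 - 3 != 0 by rewrite gt_eqF.
pose S := rho * (t - 4).
pose z : R * R := nth (0, 0) [:: (3 * (t + 4), (t + 1) * S); (3 * (t - 4), (t - 1) * S);
  (3 * (t ^+ 2 - 4 * t - 8), (t + 4) * S); (3 * (t ^+ 2 - 16), (t + 8) * S);
  (- (t + 4) * (t - 10), (t + 6) * S); (t - 4, S)] k.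
pose c : R := nth 0 [:: 3 * t; 3 * t; 3 / 2 * t; 3 / 2 * t; 3 / 2 * t; 9 / 2 * t * (t - 2)] k.
apply: (@angle_class_eq_arg _ _ _ z (cmul (cexp (1, rho) m.1) (cexp (3, rho) m.2))).
- have := @is_arg_edge_angle R P _ k gram_root c z; move: eP.
  rewrite /z /c /m; clear z c m.
  case: k => [[|[|[|[|[|[|]]]]]] hk] //= eP /(_ _ eP gram_root_gt0); apply;
    rewrite ?gram_root_sqr /gram_root /dihedral_cosnum /dist_gram /dist_dot ?mxE /=.
  all: try by move: t4; lra.
  all: rewrite ?/S; try by field.
  by move: t4; nra.
- exact: (is_argD _ _ _ _ _ _ (is_arg_cexp first_angle (1, rho) m.1 is_arg_first_angle)
                             (is_arg_cexp second_angle (3, rho) m.2 is_arg_second_angle)).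
rewrite /z /m /S; clear z c m.
case: k => [[|[|[|[|[|[|]]]]]] hk] //=; rewrite /cexp /cmul /=; rewrite et;
  [left|right|right|left|left|right]; by field.
Qed.

Lemma tetT_dehn (P : 'I_4 -> 'rV[R]_3) : dist_mx P = tetT t -> dehn P = 0.
Proof.
move=> eP; apply: (dehn_eq0 _ _ _ _ (fun k => tetT_angle_class P k eP)).
  by rewrite !big_ord_recl big_ord0 !(edge_lengthE _ _ _ eP) !mxE /=; ring.
by rewrite !big_ord_recl big_ord0 !(edge_lengthE _ _ _ eP) !mxE /=; ring.
Qed.

Lemma tetT'_dehn (P : 'I_4 -> 'rV[R]_3) : dist_mx P = tetT' t -> dehn P = 0.
Proof.
move=> eP; apply: (dehn_eq0 _ _ _ _ (fun k => tetT'_angle_class P k eP)).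
  by rewrite !big_ord_recl big_ord0 !(edge_lengthE _ _ _ eP) !mxE /=; field.
by rewrite !big_ord_recl big_ord0 !(edge_lengthE _ _ _ eP) !mxE /=; field.
Qed.

Let gram_pos : 0 < 27 * t ^+ 2 * (t + 4) * (t - 4).
Proof. by rewrite -gram_root_sqr // exprn_gt0 // gram_root_gt0. Qed.

Lemma tetT_is_tetrahedron : is_tetrahedron (tetT t).
Proof.
apply: is_tetrahedron_edgemx; rewrite -/(tetT t); try by move: t4; lra.
  rewrite [X in 0 < X](_ : _ = 36 * (t + 4) * (t - 2)); first by move: t4; nra.
  by rewrite /dist_dot !mxE /=; field.
rewrite (_ : dist_gram _ _ _ _ _ = 27 * t ^+ 2 * (t + 4) * (t - 4)) //.
by rewrite /dist_gram /dist_dot !mxE /=; field.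
Qed.

Lemma tetT'_is_tetrahedron : is_tetrahedron (tetT' t).
Proof.
apply: is_tetrahedron_edgemx; rewrite -/(tetT' t); try by move: t4; lra.
  rewrite [X in 0 < X](_ : _ = 9 * t * (t - 2) ^+ 2).
    by rewrite !mulr_gt0 ?exprn_gt0 //; move: t4; lra.
  by rewrite /dist_dot !mxE /=; field.
rewrite (_ : dist_gram _ _ _ _ _ = 27 * t ^+ 2 * (t + 4) * (t - 4)) //.
by rewrite /dist_gram /dist_dot !mxE /=; field.
Qed.

Hypothesis indep : forall c d : rat,
  c *: angle_class first_angle + d *: angle_class second_angle = 0 -> c = 0 /\ d = 0.

Lemma tetT_span (P : 'I_4 -> 'rV[R]_3) : dist_mx P = tetT t -> angle_span_dim P 2.
Proof.
move=> eP; apply: (span_dim_lattice P 0 5 (-1) (-2) (-1) (-1) _ _ _ indep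
  (fun k => tetT_angle_class P k eP)) => /=; ring.
Qed.

Lemma tetT'_span (P : 'I_4 -> 'rV[R]_3) : dist_mx P = tetT' t -> angle_span_dim P 2.
Proof.
move=> eP; apply: (span_dim_lattice P 5 4 1 0 (-2) (-1) _ _ _ indep
  (fun k => tetT'_angle_class P k eP)) => /=; ring.
Qed.
End Families.

(** * Independence of the two basic angles *)

Section Independence.
Variable R : realType.
Definition atan_comb (c d x : R) : R := c * atan x + d * atan (x / 3).

Lemma is_derive_atan_comb (c d x : R) :
  is_derive x 1 (atan_comb c d) (c / (1 + x ^+ 2) + d * 3 / (9 + x ^+ 2)).
Proof.
have h1 : is_derive x 1 (fun y : R => y / 3) 3^-1.
  rewrite (_ : (fun y : R => y / 3) = 3^-1 *: (@id R)); last first.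
    by apply/funext => y /=; rewrite mulrC.
  by apply: is_derive_eq; rewrite scaler1.
have h2 := @is_derive1_comp R atan (fun y => y / 3) x _ _ (is_derive1_atan (x / 3)) h1.
have h3 := is_deriveD (is_deriveZ c (is_derive1_atan x)) (is_deriveZ d h2).
rewrite [X in is_derive _ _ _ X](_ : _ =
  c *: (1 + x ^+ 2)^-1 + d *: ((1 + (x / 3) ^+ 2)^-1 * 3^-1)).
  exact: h3.
rewrite /GRing.scale /=.
have p1 : 1 + x ^+ 2 != 0 by rewrite lt0r_neq0 // ltr_pwDl ?sqr_ge0.
have p2 : 9 + x ^+ 2 != 0 by rewrite lt0r_neq0 // ltr_pwDl ?sqr_ge0.
rewrite (_ : 1 + (x / 3) ^+ 2 = (9 + x ^+ 2) / 9); last by field.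
by field; rewrite p1 p2.
Qed.

(** After clearing denominators the derivative is affine in z^2. *)
Lemma atan_comb_critical (c d x y : R) : x < y ->
  atan_comb c d x = atan_comb c d y ->
  exists2 z, x < z < y & (9 * c + 3 * d) + (c + 3 * d) * z ^+ 2 = 0.
Proof.
move=> xy e; have [||z] := @Rolle R (atan_comb c d) x y xy _ _ e.
- by move=> z _; have [] := is_derive_atan_comb c d z.
- apply: derivable_within_continuous => z _.
  by have [] := is_derive_atan_comb c d z.
rewrite in_itv /= => hz hd; exists z => //.
have := is_derive_atan_comb c d z => h.
have := @derive_val _ _ _ _ _ _ _ h; rewrite (@derive_val _ _ _ _ _ _ _ hd) => e0.
have p1 : 1 + z ^+ 2 != 0 by rewrite lt0r_neq0 // ltr_pwDl ?sqr_ge0.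
have p2 : 9 + z ^+ 2 != 0 by rewrite lt0r_neq0 // ltr_pwDl ?sqr_ge0.
rewrite [LHS](_ : _ = (c / (1 + z ^+ 2) + d * 3 / (9 + z ^+ 2))
   * ((1 + z ^+ 2) * (9 + z ^+ 2))); last by field; rewrite p1 p2.
by rewrite -e0 mul0r.
Qed.

Lemma finite_no_increasing_triple (A : set R) :
  (forall x y z, A x -> A y -> A z -> x < y -> y < z -> False) -> finite_set A.
Proof.
move=> H; have [[x [y [Ax Ay xy]]]|no] :=
  pselect (exists x y, [/\ A x, A y & x < y]).
  apply: (sub_finite_set (B := [set x; y])).
    move=> z Az; have [zx|xz|->] := ltgtP z x; last by left.
      by case: (H z x y).
    have [zy|yz|->] := ltgtP z y; last by right.
      by case: (H x z y).
    by case: (H x y z).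
  exact: finite_set2.
have [[x Ax]|] := pselect (exists x, A x); last first.
  by move=> /forallNP h; rewrite (_ : A = set0) //; apply/seteqP; split=> // x /h.
apply: (sub_finite_set (B := [set x])) => // z Az.
have [zx|xz|//] := ltgtP z x; case: no; first by exists z, x.
by exists x, z.
Qed.

(** Three points on a level would give two positive critical points, hence two
    distinct roots z^2 of a non-zero affine function. *)
Lemma finite_atan_comb_level (c d e : R) : (c != 0) || (d != 0) ->
  finite_set [set x | 0 < x /\ atan_comb c d x = e].
Proof.
move=> cd; apply: finite_no_increasing_triple => x y z [x0 ex] [y0 ey] [z0 ez] xy yz.
have [u /andP[xu uy] hu] := atan_comb_critical c d x y xy (etrans ex (esym ey)).
have [v /andP[yv vz] hv] := atan_comb_critical c d y z yz (etrans ey (esym ez)).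
have uv : u ^+ 2 != v ^+ 2.
  have u0 := lt_trans x0 xu; have uv := lt_trans uy yv.
  by rewrite lt_eqF // ltr_sqr ?nnegrE ?ltW // (lt_trans u0).
have k0 : c + 3 * d = 0.
  apply/eqP; move: (congr2 (fun a b => a - b) hu hv); rewrite subrr.
  rewrite [LHS](_ : _ = (c + 3 * d) * (u ^+ 2 - v ^+ 2)); last by ring.
  by move/eqP; rewrite mulf_eq0 subr_eq0 (negbTE uv) orbF.
have k1 : 9 * c + 3 * d = 0 by move: hu; rewrite k0 mul0r addr0.
have c0 : c = 0 by lra.
have d0 : d = 0 by lra.
by rewrite c0 d0 eqxx in cd.
Qed.

(** An exceptional [t] is determined by its slope, and the exceptional slopes lie in
    a countable union of finite level sets, indexed by the coefficients of the
    rational relations. *)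
Lemma ae_angles_lin_indep : {ae (@lebesgue_measure R), forall t : R, 4 < t ->
  forall c d : rat,
    c *: angle_class (first_angle R t) + d *: angle_class (second_angle R t) = 0 ->
    c = 0 /\ d = 0}.
Proof.
pose L (q : rat * rat * rat) : set R :=
  [set x | 0 < x /\ atan_comb (ratr q.1.1) (ratr q.1.2) x = ratr q.2 * pi].
pose back (r : R) : R := 4 * (r ^+ 2 + 3) / (r ^+ 2 - 3).
pose B : set R := \bigcup_(q in [set q | (q.1.1 != 0) || (q.1.2 != 0)]) (back @` L q).
have cB : countable B.
  apply: bigcup_countable => [|q hq]; first exact: countableP.
  apply: finite_set_countable; apply: finite_image.
  by apply: finite_atan_comb_level; rewrite !fmorph_eq0.
exists B; split; [exact: countable_measurable|exact: countable_lebesgue_measure0|].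
move=> t /= /not_implyP[t4 /existsNP[c /existsNP[d /not_implyP[e ncd]]]].
have [q hq] : exists q : rat, atan_comb (ratr c) (ratr d) (slope R t) = ratr q * pi.
  have e' : angle_class (ratr c * first_angle R t + ratr d * second_angle R t) = 0.
    by rewrite angle_class_is_linear -[ratr d * _]addr0 angle_class_is_linear
      angle_class0 addr0.
  by have [q hq] := (angle_class_eq0P _).1 e'; exists q.
exists (c, d, q) => /=.
  rewrite -negb_and; apply/negP => /andP[/eqP c0 /eqP d0]; exact: ncd.
exists (slope R t); first by split=> //; exact: slope_gt0.
by have [] := slopeK R t t4.
Qed.
End Independence.

(** * Regge symmetries and the three perfect matchings of the vertices *)

Section Matchings.

(** A perfect matching of the vertices, that is a pair of opposite edges, encoded as
    the involution exchanging the ends of both edges. *)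
Definition matching (p : 'I_4 -> 'I_4) := involutive p /\ forall i, p i != i.

Definition opp1 (i : 'I_4) : 'I_4 := nth v1 [:: v2; v1; v4; v3] i.
Definition opp2 (i : 'I_4) : 'I_4 := nth v1 [:: v3; v4; v1; v2] i.
Definition opp3 (i : 'I_4) : 'I_4 := nth v1 [:: v4; v3; v2; v1] i.

Lemma opp_matching : [/\ matching opp1, matching opp2 & matching opp3].
Proof. by split; split=> i; case: (ord4_cases i) => ->. Qed.

Lemma matching_cases p : matching p -> [\/ p = opp1, p = opp2 | p = opp3].
Proof.
move=> [pK pN].
have ext (q : 'I_4 -> 'I_4) :
    p v1 = q v1 -> p v2 = q v2 -> p v3 = q v3 -> p v4 = q v4 -> p = q.
  by move=> *; apply/funext => i; case: (ord4_cases i) => ->.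
have [e|e|e|e] := ord4_cases (p v1).
- by have := pN v1; rewrite e eqxx.
- have e2 : p v2 = v1 by rewrite -e pK.
  have e3 : p v3 = v4.
    have [h|h|h|//] := ord4_cases (p v3).
    + by have := pK v3; rewrite h e.
    + by have := pK v3; rewrite h e2.
    + by have := pN v3; rewrite h eqxx.
  have e4 : p v4 = v3 by rewrite -e3 pK.
  by constructor 1; exact: (ext opp1 e e2 e3 e4).
- have e2 : p v3 = v1 by rewrite -e pK.
  have e3 : p v2 = v4.
    have [h|h|h|//] := ord4_cases (p v2).
    + by have := pK v2; rewrite h e.
    + by have := pN v2; rewrite h eqxx.
    + by have := pK v2; rewrite h e2.
  have e4 : p v4 = v2 by rewrite -e3 pK.
  by constructor 2; exact: (ext opp2 e e3 e2 e4).
- have e2 : p v4 = v1 by rewrite -e pK.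
  have e3 : p v2 = v3.
    have [h|h|//|h] := ord4_cases (p v2).
    + by have := pK v2; rewrite h e.
    + by have := pN v2; rewrite h eqxx.
    + by have := pK v2; rewrite h e2.
  have e4 : p v3 = v2 by rewrite -e3 pK.
  by constructor 3; exact: (ext opp3 e e3 e4 e2).
Qed.

Definition conj_matching (s : 'S_4) (p : 'I_4 -> 'I_4) : 'I_4 -> 'I_4 :=
  fun i => s (p (s^-1%g i)).

Lemma conj_matchingE s p i : conj_matching s p (s i) = s (p i).
Proof. by rewrite /conj_matching permK. Qed.

Lemma conj_matchingP s p : matching p -> matching (conj_matching s p).
Proof.
move=> [pK pN]; split=> i; rewrite -[i](permKV s) !conj_matchingE ?pK //.
by rewrite (inj_eq perm_inj).
Qed.

Lemma conj_matching_inj s : injective (conj_matching s).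
Proof.
move=> p q e; apply/funext => i; apply: (@perm_inj _ s).
by rewrite -!conj_matchingE e.
Qed.

End Matchings.

Section Regge.
Variable R : realType.
Implicit Types (M : 'M[R]_4) (p q : 'I_4 -> 'I_4) (s : 'S_4).

Lemma sum_ord4 (F : 'I_4 -> R) : \sum_i F i = F v1 + F v2 + F v3 + F v4.
Proof.
rewrite !big_ord_recl big_ord0 addr0 !addrA.
by congr (F _ + F _ + F _ + F _); apply/val_inj.
Qed.

Definition edge_symmetric M := (forall i j, M i j = M j i) /\ forall i, M i i = 0.

Lemma edge_symmetric_edgemx (e12 e34 e13 e24 e14 e23 : R) :
  edge_symmetric (edgemx e12 e34 e13 e24 e14 e23).
Proof.
split=> [i j|i]; rewrite !mxE.
  by case: (ord4_cases i) => ->; case: (ord4_cases j) => ->.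
by case: (ord4_cases i) => ->.
Qed.

Lemma edge_symmetric_relabel s M : edge_symmetric M -> edge_symmetric (relabel s M).
Proof. by move=> [h1 h2]; split=> *; rewrite !mxE. Qed.

Lemma edge_symmetric_eq M N : edge_symmetric M -> edge_symmetric N ->
  [/\ M v1 v2 = N v1 v2, M v3 v4 = N v3 v4 & M v1 v3 = N v1 v3] ->
  [/\ M v2 v4 = N v2 v4, M v1 v4 = N v1 v4 & M v2 v3 = N v2 v3] -> M = N.
Proof.
move=> [hM M0] [hN N0] [h1 h2 h3] [h4 h5 h6]; apply/matrixP => i j.
case: (ord4_cases i) => ->; case: (ord4_cases j) => ->; rewrite ?M0 ?N0 //;
  by rewrite hM (hN _ _).
Qed.

(** The Regge symmetry fixing the pair of opposite edges given by [p], written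
    without reference to the labels so that it transforms naturally under
    relabelling.  The double sum counts each of the four other edges twice. *)
Definition regge_at p M : 'M[R]_4 :=
  let s := (\sum_i \sum_(j | (j != i) && (j != p i)) M i j) / 4 in
  \matrix_(i, j) if j == i then 0 else if j == p i then M i j else s - M i j.

Lemma regge_atE M : edge_symmetric M ->
  [/\ regge_at opp1 M = regge1 M, regge_at opp2 M = regge2 M
    & regge_at opp3 M = regge3 M].
Proof.
move=> hM; have [sM M0] := hM.
have sym p : matching p -> edge_symmetric (regge_at p M).
  move=> [pK pN]; split=> [i j|i]; rewrite !mxE ?eqxx // eq_sym.
  case: eqVneq => // _; rewrite (sM j i).
  by rewrite (_ : (i == p j) = (j == p i)) // eq_sym (can2_eq pK pK) eq_sym.
have [m1 m2 m3] := opp_matching.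
split; (apply: edge_symmetric_eq; [exact: sym | exact: edge_symmetric_edgemx | |]);
  split; rewrite !mxE //= sum_ord4; do !rewrite [\sum_(j < 4 | _) _]big_mkcond sum_ord4 /=;
  rewrite ?(sM v2 v1) ?(sM v3 v1) ?(sM v4 v1) ?(sM v3 v2) ?(sM v4 v2) ?(sM v4 v3); by field.
Qed.

Lemma regge_at_relabel p s M :
  regge_at p (relabel s M) = relabel s (regge_at (conj_matching s p) M).
Proof.
apply/matrixP => i j; rewrite !mxE conj_matchingE !(inj_eq perm_inj).
case: eqVneq => // _; case: eqVneq => // _.
congr (_ / _ - _); rewrite [RHS](reindex_inj (@perm_inj _ s)).
apply: eq_bigr => k _; rewrite [RHS](reindex_inj (@perm_inj _ s)).
by apply: eq_big => [l|l _]; rewrite ?mxE // conj_matchingE !(inj_eq perm_inj).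
Qed.

Definition is_regge (r : 'M[R]_4 -> 'M[R]_4) :=
  [\/ r = @regge1 R, r = @regge2 R | r = @regge3 R].

Lemma is_regge_at r : is_regge r ->
  exists2 p, matching p & forall M, edge_symmetric M -> r M = regge_at p M.
Proof.
have [m1 m2 m3] := opp_matching.
by case=> ->; [exists opp1|exists opp2|exists opp3] => // M /regge_atE[].
Qed.

(** Relabelling conjugates the matching of a Regge symmetry, and the conjugate is
    again one of the three matchings.  The resulting symmetry depends on [r] and
    [s] only, so the exchange holds for a whole family at once. *)
Lemma regge_relabel r s : is_regge r -> exists2 r', is_regge r' &
  forall M, edge_symmetric M -> r (relabel s M) = relabel s (r' M).
Proof.
move=> /is_regge_at[p mp hr].
suff [r' hr' e] : exists2 r', is_regge r' &
    forall M, edge_symmetric M -> r' M = regge_at (conj_matching s p) M.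
  exists r' => // M hM.
  by rewrite hr ?regge_at_relabel ?e //; exact: edge_symmetric_relabel.
have [->|->|->] := matching_cases _ (conj_matchingP s _ mp).
- by exists (@regge1 R); [constructor 1|move=> M /regge_atE[]].
- by exists (@regge2 R); [constructor 2|move=> M /regge_atE[]].
- by exists (@regge3 R); [constructor 3|move=> M /regge_atE[]].
Qed.

Lemma relabel_relabel s s' M : relabel s (relabel s' M) = relabel (s * s')%g M.
Proof. by apply/matrixP => i j; rewrite !mxE !permM. Qed.

Lemma relabel1 M : relabel 1%g M = M.
Proof. by apply/matrixP => i j; rewrite !mxE !perm1. Qed.

Lemma relabelK s : cancel (@relabel R s) (relabel s^-1%g).
Proof. by move=> M; rewrite relabel_relabel mulVg relabel1. Qed.

Lemma regge_composite_edge_symmetric g M : regge_composite g ->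
  edge_symmetric M -> edge_symmetric (g M).
Proof.
move=> hg hM; elim: hg => [|s {}g _ IH|{}g _ _|{}g _ _|{}g _ _] //=;
  try exact: edge_symmetric_edgemx.
exact: edge_symmetric_relabel.
Qed.

(** Twice the sum of the two opposite edges of the pair given by [p]. *)
Definition pair_sum p M : R := \sum_i M i (p i).

(** The invariant that separates the two families from the Hill families: two of
    the three sums of opposite edges agree. *)
Definition balanced M := exists p q,
  [/\ matching p, matching q, p <> q & pair_sum p M = pair_sum q M].

Lemma pair_sum_relabel p s M :
  pair_sum p (relabel s M) = pair_sum (conj_matching s p) M.
Proof.
rewrite /pair_sum [RHS](reindex_inj (@perm_inj _ s)).
by apply: eq_bigr => i _; rewrite mxE conj_matchingE.
Qed.

Lemma balanced_relabelW s M : balanced (relabel s M) -> balanced M.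
Proof.
move=> [p [q [mp mq pq e]]]; exists (conj_matching s p), (conj_matching s q).
split; [exact: conj_matchingP|exact: conj_matchingP| |].
  by move/conj_matching_inj.
by rewrite -!pair_sum_relabel.
Qed.

Lemma balanced_relabel s M : balanced (relabel s M) <-> balanced M.
Proof.
split; first exact: balanced_relabelW.
by rewrite -{1}(relabelK s M); exact: balanced_relabelW.
Qed.

Lemma balanced_scale (c : R) M : 0 < c -> balanced (c *: M) <-> balanced M.
Proof.
move=> c0; have e p : pair_sum p (c *: M) = c * pair_sum p M.
  by rewrite /pair_sum mulr_sumr; apply: eq_bigr => i _; rewrite mxE.
split=> -[p [q [mp mq pq h]]]; exists p, q; split=> //.
  by move: h; rewrite !e => /(mulfI (lt0r_neq0 c0)).
by rewrite !e h.
Qed.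

Lemma balancedP M : edge_symmetric M -> balanced M <->
  [\/ M v1 v2 + M v3 v4 = M v1 v3 + M v2 v4,
      M v1 v3 + M v2 v4 = M v1 v4 + M v2 v3 |
      M v1 v2 + M v3 v4 = M v1 v4 + M v2 v3].
Proof.
move=> [sM M0].
have [m1 m2 m3] := opp_matching.
have s1 : pair_sum opp1 M = 2 * (M v1 v2 + M v3 v4).
  by rewrite /pair_sum sum_ord4 /= (sM v2) (sM v4); ring.
have s2 : pair_sum opp2 M = 2 * (M v1 v3 + M v2 v4).
  by rewrite /pair_sum sum_ord4 /= (sM v3) (sM v4); ring.
have s3 : pair_sum opp3 M = 2 * (M v1 v4 + M v2 v3).
  by rewrite /pair_sum sum_ord4 /= (sM v3) (sM v4); ring.
have ne p q : p v1 <> q v1 -> p <> q :> ('I_4 -> 'I_4) by move=> h e; rewrite e in h.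
split; last first.
  case=> h; [exists opp1, opp2|exists opp2, opp3|exists opp1, opp3];
    by split=> //; [exact: ne|rewrite ?s1 ?s2 ?s3 h].
have inj2 (x y : R) : 2 * x = 2 * y -> x = y by apply: mulfI; rewrite pnatr_eq0.
move=> [p [q [/matching_cases mp /matching_cases mq]]].
case: mp => ->; case: mq => -> // _; rewrite ?s1 ?s2 ?s3 => /inj2 h;
  by [constructor 1|constructor 2|constructor 3].
Qed.

(** With s half the sum of the other two pair sums, a Regge symmetry replaces each
    of these by 2 s minus itself, and so exchanges them. *)
Lemma balanced_regge r M : is_regge r -> edge_symmetric M ->
  balanced (r M) -> balanced M.
Proof.
move=> hr hM; have hrM : edge_symmetric (r M).
  by case: hr => ->; exact: edge_symmetric_edgemx.
move=> /(balancedP _ hrM) h; apply/(balancedP _ hM); move: h.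
case: hr => ->; rewrite !mxE /= => -[|/esym|] h.
all: try (by constructor 1; lra); try (by constructor 2; lra); by constructor 3; lra.
Qed.

Lemma balanced_regge_composite g M : regge_composite g -> edge_symmetric M ->
  balanced (g M) -> balanced M.
Proof.
move=> hg hM; elim: hg => [|s {}g _ IH|{}g hg IH|{}g hg IH|{}g hg IH] //=.
- by move/balanced_relabel.
- move/(balanced_regge _ _ (Or31 _ _ erefl)) => h; apply/IH/h.
  exact: regge_composite_edge_symmetric.
- move/(balanced_regge _ _ (Or32 _ _ erefl)) => h; apply/IH/h.
  exact: regge_composite_edge_symmetric.
- move/(balanced_regge _ _ (Or33 _ _ erefl)) => h; apply/IH/h.
  exact: regge_composite_edge_symmetric.
Qed.

End Regge.

(** * The Regge class of the two families *)

Section Orbit.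
Variable R : realType.
Implicit Types (M : 'M[R]_4) (s : 'S_4) (t : R).

Definition is_tet_param (F : R -> 'M[R]_4) := F = @tetT R \/ F = @tetT' R.

Lemma edge_symmetric_tet F t : is_tet_param F -> edge_symmetric R (F t).
Proof. by case=> ->; exact: edge_symmetric_edgemx. Qed.

Lemma edgemxE (e12 e34 e13 e24 e14 e23 : R) :
  let M := edgemx e12 e34 e13 e24 e14 e23 in
  (M v1 v2 = e12) * (M v2 v1 = e12) * (M v3 v4 = e34) * (M v4 v3 = e34) *
  (M v1 v3 = e13) * (M v3 v1 = e13) * (M v2 v4 = e24) * (M v4 v2 = e24) *
  (M v1 v4 = e14) * (M v4 v1 = e14) * (M v2 v3 = e23) * (M v3 v2 = e23).
Proof. by split; [repeat split|]; rewrite mxE. Qed.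

Lemma regge1_tetT t : regge1 (tetT t) = tetT' t.
Proof. by rewrite /regge1 /tetT' !mxE /=; congr edgemx; field. Qed.

Lemma regge1_tetT' t : regge1 (tetT' t) = tetT t.
Proof. by rewrite /regge1 /tetT !mxE /=; congr edgemx; field. Qed.

(** The first symmetry exchanges T and T'.  The symmetry of T under exchanging
    vertices 2 and 3 turns its second Regge symmetry into the first; in the three
    other cases the lengths of the four edges outside the fixed pair are merely
    permuted. *)
Lemma regge_tet r F : is_regge R r -> is_tet_param F ->
  exists s, exists2 F', is_tet_param F' & forall t, r (F t) = relabel s (F' t).
Proof.
move=> hr hF.
suff [s [F' hF' e]] : exists s, exists2 F', is_tet_param F' &
    forall t, let N := relabel s (F' t) in
    [/\ r (F t) v1 v2 = N v1 v2, r (F t) v3 v4 = N v3 v4 & r (F t) v1 v3 = N v1 v3] /\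
    [/\ r (F t) v2 v4 = N v2 v4, r (F t) v1 v4 = N v1 v4 & r (F t) v2 v3 = N v2 v3].
  exists s, F' => // t; have [h1 h2] := e t; apply: edge_symmetric_eq h1 h2.
    by case: hr => ->; exact: edge_symmetric_edgemx.
  by apply: edge_symmetric_relabel; exact: edge_symmetric_tet.
have s23 : [/\ tperm v2 v3 v1 = v1, tperm v2 v3 v2 = v3, tperm v2 v3 v3 = v2
    & tperm v2 v3 v4 = v4] by split; rewrite permE.
pose s1423 := (tperm v1 v4 * tperm v2 v3)%g.
have s1423E : [/\ s1423 v1 = v4, s1423 v2 = v3, s1423 v3 = v2 & s1423 v4 = v1].
  by split; rewrite permM !permE.
pose s1324 := (tperm v1 v3 * tperm v2 v4)%g.
have s1324E : [/\ s1324 v1 = v3, s1324 v2 = v4, s1324 v3 = v1 & s1324 v4 = v2].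
  by split; rewrite permM !permE.
case: hF => ->; case: hr => -> /=.
- exists 1%g, (@tetT' R); first by right.
  by move=> t; rewrite relabel1 regge1_tetT.
- exists (tperm v2 v3), (@tetT' R); first by right.
  move=> t; rewrite ![relabel _ _ _ _]mxE; case: s23 => -> -> -> ->.
  by rewrite /regge2 /regge3 /tetT /tetT' !edgemxE; split; split; field.
- exists s1423, (@tetT R); first by left.
  move=> t; rewrite ![relabel _ _ _ _]mxE; case: s1423E => -> -> -> ->.
  by rewrite /regge2 /regge3 /tetT /tetT' !edgemxE; split; split; field.
- exists 1%g, (@tetT R); first by left.
  by move=> t; rewrite relabel1 regge1_tetT'.
- exists s1324, (@tetT' R); first by right.
  move=> t; rewrite ![relabel _ _ _ _]mxE; case: s1324E => -> -> -> ->.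
  by rewrite /regge2 /regge3 /tetT /tetT' !edgemxE; split; split; field.
- exists (tperm v2 v3), (@tetT' R); first by right.
  move=> t; rewrite ![relabel _ _ _ _]mxE; case: s23 => -> -> -> ->.
  by rewrite /regge2 /regge3 /tetT /tetT' !edgemxE; split; split; field.
Qed.

(** The relabelling and the target family are independent of [t]: this is what
    makes the image of the whole family a single family. *)
Lemma regge_composite_tet g F : regge_composite g -> is_tet_param F ->
  exists s, exists2 F', is_tet_param F' & forall t, g (F t) = relabel s (F' t).
Proof.
move=> hg hF; have step r g' : is_regge R r ->
    (exists s, exists2 F', is_tet_param F' & forall t, g' (F t) = relabel s (F' t)) ->
    exists s, exists2 F', is_tet_param F' & forall t, r (g' (F t)) = relabel s (F' t).
  move=> hr [s [F' hF' e]]; have [r' hr' er] := regge_relabel R r s hr.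
  have [s' [F'' hF'' e']] := regge_tet r' F' hr' hF'.
  exists (s * s')%g, F'' => // t.
  by rewrite e er ?e' ?relabel_relabel //; exact: edge_symmetric_tet.
elim: hg => [|s {}g _ [s' [F' hF' e]]|{}g _ IH|{}g _ IH|{}g _ IH].
- by exists 1%g, F => // t; rewrite relabel1.
- by exists (s * s')%g, F' => // t; rewrite /= e relabel_relabel.
- by apply: (step (@regge1 R) g) => //; constructor 1.
- by apply: (step (@regge2 R) g) => //; constructor 2.
- by apply: (step (@regge3 R) g) => //; constructor 3.
Qed.

Definition tet_family (F : R -> 'M[R]_4) : set 'M[R]_4 := [set F t | t in [set t | 4 < t]].

Lemma shapes_relabel_family g s F F' :
  (forall t, g (F t) = relabel s (F' t)) ->
  same_family (g @` tet_family F) (tet_family F').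
Proof.
move=> e; apply/seteqP; split=> M [N [s' [c [hN [c0 ->]]]]].
  case: hN => _ [t t4 <-] <-; exists (F' t), (s' * s)%g, c.
  by rewrite e relabel_relabel; split=> //; exists t.
case: hN => t t4 <-; exists (g (F t)), (s' * s^-1)%g, c; split.
  by exists (F t) => //; exists t.
by rewrite e relabel_relabel -mulgA mulVg mulg1.
Qed.

Lemma regge_equiv_tet F F' : is_tet_param F -> is_tet_param F' ->
  exists2 g, regge_composite g & g @` tet_family F = tet_family F'.
Proof.
have im (g : 'M[R]_4 -> 'M[R]_4) G G' : (forall t, g (G t) = G' t) ->
    g @` tet_family G = tet_family G'.
  move=> e; apply/seteqP; split=> [_ [_ [t t4 <-] <-]|_ [t t4 <-]].
    by rewrite e; exists t.
  by exists (G t); [exists t|].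
case=> ->; case=> ->.
- by exists id; [exact: regge_composite_id|exact: im].
- exists (@regge1 R \o id); last by apply: im => t; exact: regge1_tetT.
  exact/regge_composite_regge1/regge_composite_id.
- exists (@regge1 R \o id); last by apply: im => t; exact: regge1_tetT'.
  exact/regge_composite_regge1/regge_composite_id.
- by exists id; [exact: regge_composite_id|exact: im].
Qed.

Lemma regge_equiv_tetP F G : is_tet_param F ->
  regge_equiv (tet_family F) G <-> exists2 F', is_tet_param F' & same_family G (tet_family F').
Proof.
move=> hF; split=> [[g [hg e]]|[F' hF' e]].
  have [s [F' hF' eg]] := regge_composite_tet g F hg hF.
  exists F' => //; rewrite /same_family -e; exact: shapes_relabel_family eg.
have [g hg eg] := regge_equiv_tet F F' hF hF'.
by exists g; split=> //; rewrite /same_family eg e.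
Qed.

Lemma balanced_tet F t : is_tet_param F -> balanced R (F t).
Proof.
case=> ->; apply/balancedP; try exact: edge_symmetric_edgemx; rewrite !mxE /=.
  by constructor 1.
by constructor 3; field.
Qed.

Lemma balanced_shapes (F : set 'M[R]_4) M :
  (forall N, F N -> balanced R N) -> shapes F M -> balanced R M.
Proof.
move=> hF [N [s [c [/hF hN [c0 ->]]]]].
by apply/balanced_scale => //; apply/balanced_relabel.
Qed.

Lemma shapes_self (F : set 'M[R]_4) M : F M -> shapes F M.
Proof. by move=> FM; exists M, 1%g, 1; rewrite relabel1 scale1r. Qed.

(** Every shape in the Regge class of T and T' is balanced.  In the direction from
    [H] the labels may vary along the family, but a composite sends no unbalanced
    matrix to a balanced one. *)
Lemma unbalanced_not_equiv F (H : set 'M[R]_4) N : is_tet_param F ->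
  H N -> edge_symmetric R N -> ~ balanced R N ->
  [/\ ~ same_family (tet_family F) H, ~ regge_equiv (tet_family F) H
    & ~ regge_equiv H (tet_family F)].
Proof.
move=> hF HN sN nN.
have bal G : is_tet_param G -> forall M, shapes (tet_family G) M -> balanced R M.
  move=> hG M; apply: balanced_shapes => _ [t _ <-]; exact: balanced_tet.
have not_same G : is_tet_param G -> ~ same_family (tet_family G) H.
  by move=> hG e; apply/nN/(bal G hG); rewrite e; exact: shapes_self.
split; first exact: not_same.
  by move/(regge_equiv_tetP _ _ hF) => [F' hF' e]; apply: (not_same F').
move=> [g [hg e]]; apply: nN; apply: (balanced_regge_composite R g) => //.
by apply: (bal F hF); rewrite -e; apply: shapes_self; exists N.
Qed.

End Orbit.

(** * Members of the Hill families with distinct opposite edge sums *)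

Section Hill.
Variable R : realType.

Lemma acos_pythagorean (c s : R) : 0 <= c < 1 -> 0 <= s -> c ^+ 2 + s ^+ 2 = 1 ->
  [/\ 0 < acos c < pi, cos (acos c) = c & sin (acos c) = s].
Proof.
move=> /andP[c0 c1] s0 e.
have hc : -1 <= c <= 1 by apply/andP; split; lra.
split; first by rewrite acos_gt0 ?acos_ltpi //; apply/andP; split; lra.
  by rewrite acosK // in_itv.
by rewrite sin_acos // (_ : 1 - c ^+ 2 = s ^+ 2) ?sqrtr_sqr ?ger0_norm // -e; ring.
Qed.

Lemma sqrt3_spec : 0 <= Num.sqrt 3 :> R /\ Num.sqrt 3 ^+ 2 = 3 :> R.
Proof. by rewrite sqrtr_ge0 sqr_sqrtr. Qed.

(** At cosine 1/2, which serves for the other two Hill families, the pair sums in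
    H_1 at the edges 12 and 13 agree; cosine 3/5 keeps the sine rational. *)
Lemma hill1_unbalanced : exists2 N, hill_family (@tetH1 R) N & ~ balanced R N.
Proof.
have [x0 x2] := sqrt3_spec; set x := Num.sqrt 3 in x0 x2.
have [|||a0 ca sa] := @acos_pythagorean (3 / 5) (4 / 5); [lra|lra|by field|].
have eH : tetH1 (acos (3 / 5)) = edgemx (4 / 5) (4 / 5) (x * (3 / 5)) (4 / 5) 1 1.
  by rewrite /tetH1 sa ca.
exists (tetH1 (acos (3 / 5))).
  exists (acos (3 / 5)) => //; split=> //; rewrite eH.
  apply: is_tetrahedron_edgemx; rewrite ?mulr_ge0 //; try lra;
    rewrite /dist_gram /dist_dot !mxE /= ![(x * _) ^+ 2]exprMn x2; lra.
rewrite eH => /balancedP; rewrite !mxE /= => h.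
by case: (h (edge_symmetric_edgemx _ _ _ _ _ _ _)) => {}h; nra.
Qed.

(** For x = sqrt 3 and w = sqrt (11/4) these are the pair sums of the members of
    H_2 and H_3 at angle pi / 3. *)
Lemma hill23_pair_sums_neq (x w : R) : 0 <= x -> 0 <= w -> x ^+ 2 = 3 -> w ^+ 2 = 11 / 4 ->
  [/\ x + w <> x / 2 + x, x / 2 + x <> 2 + w & x + w <> 2 + w].
Proof.
move=> x0 w0 x2 w2; split=> h; first nra.
  have : x < 9 / 5 by nra.
  have : 1 < w by nra.
  by lra.
by nra.
Qed.

Lemma acos_half : [/\ 0 < acos (1 / 2 : R) < pi, cos (acos (1 / 2 : R)) = 1 / 2
  & sin (acos (1 / 2 : R)) = Num.sqrt 3 / 2].
Proof.
have [x0 x2] := sqrt3_spec.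
apply: acos_pythagorean; [lra|lra|].
by rewrite [(Num.sqrt 3 / 2) ^+ 2]expr_div_n x2; field.
Qed.

Lemma hill2_unbalanced : exists2 N, hill_family (@tetH2 R) N & ~ balanced R N.
Proof.
have [x0 x2] := sqrt3_spec; have [a0 ca sa] := acos_half.
set x := Num.sqrt 3 in x0 x2 sa; pose w : R := Num.sqrt (11 / 4).
have w0 : 0 <= w by exact: sqrtr_ge0.
have w2 : w ^+ 2 = 11 / 4 by rewrite sqr_sqrtr; lra.
have eH : tetH2 (acos (1 / 2)) = edgemx x w (x / 2) x 2 w.
  rewrite /tetH2 sa ca (_ : 5 * _ - 1 = 11 / 4) -/x -/w.
    by congr edgemx; field.
  by rewrite expr_div_n x2; field.
exists (tetH2 (acos (1 / 2))).
  exists (acos (1 / 2)) => //; split=> //; rewrite eH.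
  apply: is_tetrahedron_edgemx => //; try nra;
    rewrite /dist_gram /dist_dot !mxE /= ?[(x / _) ^+ 2]expr_div_n ?x2 ?w2; lra.
rewrite eH => /balancedP; rewrite !mxE /= => h.
have [h1 h2 h3] := hill23_pair_sums_neq x w x0 w0 x2 w2.
by case: (h (edge_symmetric_edgemx _ _ _ _ _ _ _)).
Qed.

Lemma hill3_unbalanced : exists2 N, hill_family (@tetH3 R) N & ~ balanced R N.
Proof.
have [x0 x2] := sqrt3_spec; have [a0 ca sa] := acos_half.
set x := Num.sqrt 3 in x0 x2 sa; pose w : R := Num.sqrt (11 / 4).
have w0 : 0 <= w by exact: sqrtr_ge0.
have w2 : w ^+ 2 = 11 / 4 by rewrite sqr_sqrtr; lra.
have e12 : Num.sqrt 12 = 2 * x.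
  rewrite (_ : 12 = (2 * x) ^+ 2); last by rewrite exprMn x2; ring.
  by rewrite sqrtr_sqr ger0_norm // mulr_ge0.
have eH : tetH3 (acos (1 / 2)) = edgemx x w x (x / 2) w 2.
  rewrite /tetH3 sa ca e12 (_ : _ ^+ 2 + 2 = 11 / 4) -/x -/w.
    by congr edgemx; field.
  by rewrite expr_div_n x2; field.
exists (tetH3 (acos (1 / 2))).
  exists (acos (1 / 2)) => //; split=> //; rewrite eH.
  apply: is_tetrahedron_edgemx => //; try nra;
    rewrite /dist_gram /dist_dot !mxE /= ?[(x / _) ^+ 2]expr_div_n ?x2 ?w2; lra.
rewrite eH => /balancedP; rewrite !mxE /= => h.
have [h1 h2 h3] := hill23_pair_sums_neq x w x0 w0 x2 w2.
by case: (h (edge_symmetric_edgemx _ _ _ _ _ _ _)); [move: h1|move: h2|move: h3]; lra.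
Qed.

End Hill.

(** * Two families of tetrahedra with vanishing Dehn invariant *)

Theorem theorem1p2 (R : realType) :
  [/\ (forall t : R, 4 < t ->
        [/\ is_tetrahedron (tetT t), is_tetrahedron (tetT' t),
            (forall P, nondegenerate_tetrahedron P -> dist_mx P = tetT t -> dehn P = 0) &
            (forall P, nondegenerate_tetrahedron P -> dist_mx P = tetT' t -> dehn P = 0)]),
      {ae (@lebesgue_measure R), forall t : R, 4 < t ->
        forall P, nondegenerate_tetrahedron P -> dist_mx P = tetT t -> angle_span_dim P 2} /\
      {ae (@lebesgue_measure R), forall t : R, 4 < t ->
        forall P, nondegenerate_tetrahedron P -> dist_mx P = tetT' t -> angle_span_dim P 2},
      (forall F H : set 'M[R]_4,
        F = @familyT R \/ F = @familyT' R ->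
        [\/ H = hill_family (@tetH1 R), H = hill_family (@tetH2 R) |
            H = hill_family (@tetH3 R)] ->
        [/\ ~ same_family F H, ~ regge_equiv F H & ~ regge_equiv H F]) &
      (forall F G : set 'M[R]_4, F = @familyT R \/ F = @familyT' R ->
        (regge_equiv F G <->
          same_family G (@familyT R) \/ same_family G (@familyT' R)))].
Proof.
have isF F : F = @familyT R \/ F = @familyT' R ->
    exists2 f, is_tet_param R f & F = tet_family R f.
  by case=> ->; [exists (@tetT R) => //; left|exists (@tetT' R) => //; right].
split.
- move=> t t4; split.
  + exact: tetT_is_tetrahedron.
  + exact: tetT'_is_tetrahedron.
  + by move=> P _; exact: tetT_dehn.
  + by move=> P _; exact: tetT'_dehn.
- have [B [mB B0 hB]] := ae_angles_lin_indep R; split; exists B; split=> // t nt;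
    apply: hB => /= h; apply: nt => /= t4 P _; [apply: tetT_span|apply: tetT'_span];
    by [|exact: h].
- move=> F H /isF[f hf ->] hH.
  have [N HN nN] : exists2 N, H N & ~ balanced R N.
    by case: hH => ->; [exact: hill1_unbalanced|exact: hill2_unbalanced|
      exact: hill3_unbalanced].
  apply: (unbalanced_not_equiv _ _ _ _ hf HN _ nN).
  by case: hH HN => -> [a _ <-]; exact: edge_symmetric_edgemx.
- move=> F G /isF[f hf ->]; rewrite (regge_equiv_tetP _ _ _ hf).
  split=> [[F' [->|->] e]|[e|e]]; [by left|by right| |].
    by exists (@tetT R) => //; left.
  by exists (@tetT' R) => //; right.
Qed.
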